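(* Let $p,q,q'\in[1,\infty]$ with $q'\leq q$, and let $E$ and $L$ be locally convex spaces. If $L$ contains an isomorphic copy of $\ell_\infty$ (i.e. a subspace linearly homeomorphic to the Banach space $\ell_\infty$), then the following assertions are equivalent: (i) each weakly $p$-convergent operator from $E$ into $L$ is $(q',q)$-limited $p$-convergent; (ii) each weak$^\ast$ $p$-convergent operator from $E$ into $L$ is $(q',q)$-limited $p$-convergent; (iii) the identity operator $\mathrm{id}_E:E\to E$ is $(q',q)$-limited $p$-convergent.
   Context: All locally convex spaces are Hausdorff and over the field $\mathbb{F}\in\{\mathbb{R},\mathbb{C}\}$. ''Operator'' means continuous linear map. $E'$ is the topological dual of $E$; $E'_\beta$ is $E'$ with the strong topology $\beta(E',E)$. A sequence $\{x_n\}$ in $E$ is weakly $p$-summable if for every $\chi\in E'$, $(\langle\chi,x_n\rangle)_n\in\ell_p$ if $p<\infty$, and $(\langle\chi,x_n\rangle)_n\in c_0$ if $p=\infty$. A sequence $\{\chi_n\}$ in $E'$ is weak$^\ast$ $p$-summable if for every $x\in E$, $(\langle\chi_n,x\rangle)_n\in\ell_p$ (in $c_0$ if $p=\infty$). For $q'\le q$, a non-empty $A\subseteq E$ is a $(q',q)$-limited set if $\big(\sup_{a\in A}|\langle\chi_n,a\rangle|\big)_n$ belongs to $\ell_q$ (to $c_0$ if $q=\infty$) for every weak$^\ast$ $q'$-summable sequence $\{\chi_n\}$ in $E'$. A linear map $T:E\to L$ is: weakly $p$-convergent if $\lim_n\langle\eta_n,T(x_n)\rangle=0$ for every weakly null sequence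 $\{\eta_n\}$ in $L'_\beta$ and every weakly $p$-summable sequence $\{x_n\}$ in $E$; weak$^\ast$ $p$-convergent if the same limit holds for every weak$^\ast$ null sequence $\{\eta_n\}$ in $L'$ and every weakly $p$-summable $\{x_n\}$ in $E$; $(q',q)$-limited $p$-convergent if $T(x_n)\to0$ for every weakly $p$-summable sequence $\{x_n\}$ in $E$ which is a $(q',q)$-limited subset of $E$. *)

(* Defs.v *)
From HB Require Import structures.
From mathcomp Require Import all_boot all_order all_algebra.
From mathcomp Require Import all_classical all_reals all_analysis.
From mathcomp.real_closed Require Import complex.

Set Implicit Arguments.
Unset Strict Implicit.
Unset Printing Implicit Defensive.

Import Order.TTheory GRing.Theory Num.Theory.
Import numFieldNormedType.Exports.

Local Open Scope classical_set_scope.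
Local Open Scope ring_scope.

(* The scalar field, either the reals or the complex numbers.  The norm of
   [scalar_field R k] takes its values in [scalar_field R k] itself; [modulus] is the
   same norm with values in [R], and [of_real] is the inclusion of [R]. *)
Variant scalar_kind := RealScalars | ComplexScalars.

Definition scalar_field (R : realType) (k : scalar_kind) : numFieldType :=
  match k with
  | RealScalars => R
  | ComplexScalars => R[i]%C
  end.

Definition modulus (R : realType) (k : scalar_kind) : scalar_field R k -> R :=
  match k with
  | RealScalars => fun x : R => `|x|
  | ComplexScalars => fun z : R[i]%C => complex.Re `|z|
  end.

Definition of_real (R : realType) (k : scalar_kind) : R -> scalar_field R k :=
  match k with
  | RealScalars => fun x : R => x
  | ComplexScalars => fun x : R => x%:C%C
  end.
Arguments of_real R k x : clear implicits.

Section scalar_theory.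
Context {R : realType} {k : scalar_kind}.
Implicit Types (x y : R) (a b : scalar_field R k).

Lemma of_real_modulus a : of_real R k (modulus a) = `|a|.
Proof.
by case: k a => //= -[u v]; rewrite /modulus/= normc_def.
Qed.

Lemma ler_of_real x y : (of_real R k x <= of_real R k y) = (x <= y).
Proof. by case: k => //=; rewrite lecR. Qed.

Lemma of_real_inj : injective (of_real R k).
Proof.
by move=> x y xy; apply/le_anti; rewrite -!ler_of_real xy lexx.
Qed.

Lemma of_real0 : of_real R k 0 = 0.
Proof. by case: k. Qed.

Lemma of_realD x y : of_real R k (x + y) = of_real R k x + of_real R k y.
Proof. by case: k => //=; rewrite rmorphD. Qed.

Lemma of_realM x y : of_real R k (x * y) = of_real R k x * of_real R k y.
Proof. by case: k => //=; rewrite rmorphM. Qed.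

Lemma modulus_ge0 a : 0 <= modulus a.
Proof. by rewrite -ler_of_real of_real_modulus of_real0. Qed.

Lemma modulus0 : modulus (0 : scalar_field R k) = 0.
Proof. by apply: of_real_inj; rewrite of_real_modulus normr0 of_real0. Qed.

Lemma modulus_eq0 a : modulus a = 0 -> a = 0.
Proof. by move=> a0; apply/normr0_eq0; rewrite -of_real_modulus a0 of_real0. Qed.

Lemma modulusD a b : modulus (a + b) <= modulus a + modulus b.
Proof. by rewrite -ler_of_real of_realD !of_real_modulus ler_normD. Qed.

Lemma modulusM a b : modulus (a * b) = modulus a * modulus b.
Proof. by apply: of_real_inj; rewrite of_realM !of_real_modulus normrM. Qed.

End scalar_theory.

Section topological_dual.
Context {K : numFieldType}.
Variable E : preTopologicalLmodType K.

Definition continuous_functional : {pred E -> K^o} :=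
  fun f => `[< linear f /\ continuous f >].

Record topdual := Topdual {
  topdual_fun :> E -> K^o ;
  topdualP : topdual_fun \in continuous_functional }.

HB.instance Definition _ := [isSub for topdual_fun].
HB.instance Definition _ := [Choice of topdual by <:].

Lemma continuous_functional_submod_closed :
  submod_closed continuous_functional.
Proof.
split.
  apply/asboolP; split; last exact: cst_continuous.
  by move=> a x y /=; rewrite scaler0 addr0.
move=> a f g /asboolP[lf cf] /asboolP[lg cg]; apply/asboolP; split.
  move=> b x y; rewrite !fctE lf lg scalerDr scalerDr addrACA; congr (_ + _).
  by congr (_ + _); rewrite !scalerA mulrC.
move=> x; apply: cvgD; last exact: cg.
by apply: cvgZr; exact: cf.
Qed.

HB.instance Definition _ := GRing.isSubmodClosed.Build K (E -> K^o)
  continuous_functional continuous_functional_submod_closed.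
HB.instance Definition _ := [SubChoice_isSubLmodule of topdual by <:].

(* [0 < r] forces [r] to be real when [K] is the field of complex numbers *)
Definition absorbs (U A : set E) := exists2 r : K, 0 < r &
  forall t : K, r <= `|t| -> A `<=` [set t *: u | u in U].

Definition vn_bounded (A : set E) := forall U, nbhs 0 U -> absorbs U A.

(* E'_beta: the dual with the topology beta(E', E) of uniform convergence on
   the bounded subsets of E *)
Definition strong_dual : Type := topdual.

Definition to_family (f : topdual) : {family vn_bounded, E -> K^o} := f.

HB.instance Definition _ := GRing.Lmodule.on strong_dual.
HB.instance Definition _ :=
  Topological.copy strong_dual (initial_topology to_family).

End topological_dual.

Section linfty.
Context {R : realType} {k : scalar_kind}.
Local Notation K := (scalar_field R k).

Definition bounded_seq : {pred nat -> K^o} :=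
  fun a => `[< has_ubound (range (fun n => modulus (a n))) >].

Record linfty := Linfty {
  linfty_seq :> nat -> K^o ;
  linftyP : linfty_seq \in bounded_seq }.

HB.instance Definition _ := [isSub for linfty_seq].
HB.instance Definition _ := [Choice of linfty by <:].

Lemma bounded_seq_submod_closed : submod_closed bounded_seq.
Proof.
split.
  by apply/asboolP; exists 0 => _ [n _ <-]; rewrite modulus0.
move=> a f g /asboolP[M fM] /asboolP[N gN]; apply/asboolP.
exists (modulus a * M + N) => _ [n _ <-].
rewrite (le_trans (modulusD _ _))// lerD//; last by apply: gN; exists n.
by rewrite modulusM ler_wpM2l ?modulus_ge0//; apply: fM; exists n.
Qed.

HB.instance Definition _ := GRing.isSubmodClosed.Build K (nat -> K^o)
  bounded_seq bounded_seq_submod_closed.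
HB.instance Definition _ := [SubChoice_isSubLmodule of linfty by <:].

Definition sup_norm (a : linfty) : R := sup (range (fun n => modulus (a n))).

Lemma modulus_le_sup_norm (a : linfty) n : modulus (a n) <= sup_norm a.
Proof.
by apply: ub_le_sup; [exact/asboolP/linftyP|exists n].
Qed.

Lemma sup_norm_le (a : linfty) M :
  (forall n, modulus (a n) <= M) -> sup_norm a <= M.
Proof.
move=> aM; apply: ge_sup; first by exists (modulus (a 0%N)), 0%N.
by move=> _ [n _ <-].
Qed.

Let norm (a : linfty) : K := of_real R k (sup_norm a).

Let norm_triangle a b : norm (a + b) <= norm a + norm b.
Proof.
rewrite -of_realD ler_of_real; apply: sup_norm_le => n.
by rewrite (le_trans (modulusD _ _))// lerD// modulus_le_sup_norm.
Qed.

Let norm_scale (l : K) a : norm (l *: a) = `|l| * norm a.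
Proof.
rewrite -of_real_modulus -of_realM; congr of_real.
apply/le_anti/andP; split.
  by apply: sup_norm_le => n; rewrite modulusM ler_wpM2l ?modulus_ge0//
    modulus_le_sup_norm.
have [->|l0] := eqVneq l 0.
  by rewrite modulus0 mul0r (le_trans (modulus_ge0 _) (modulus_le_sup_norm _ 0%N)).
have ml : 0 < modulus l.
  by rewrite lt_neqAle modulus_ge0 andbT eq_sym; apply: contra_neq l0 => /modulus_eq0.
rewrite mulrC -ler_pdivlMr//; apply: sup_norm_le => n.
rewrite ler_pdivlMr// mulrC -modulusM.
exact: (modulus_le_sup_norm (l *: a)).
Qed.

Let norm_eq0 a : norm a = 0 -> a = 0.
Proof.
rewrite /norm -(@of_real0 R k) => /of_real_inj a0.
apply/val_inj/funext => n; apply/modulus_eq0/le_anti.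
by rewrite modulus_ge0 andbT -a0 modulus_le_sup_norm.
Qed.

HB.instance Definition _ :=
  Lmodule_isNormed.Build K linfty norm_triangle norm_scale norm_eq0.

End linfty.
Arguments linfty : clear implicits.

Section locally_convex.
Context {R : realType} {k : scalar_kind}.
Local Notation K := (scalar_field R k).
Implicit Types p q : \bar R.

(* membership in l_p for finite p, and in c_0 (not l_oo) for p = +oo *)
Definition ell_c0 p (u : nat -> R) : Prop :=
  match p with
  | r%:E => cvgn (series (fun n => `|u n| `^ r))
  | +oo%E => u @ \oo --> 0
  | -oo%E => False
  end.

Definition weakly_p_summable p (E : preTopologicalLmodType K) (x : nat -> E) :=
  forall chi : topdual E, ell_c0 p (fun n => modulus (chi (x n))).

Definition weakstar_p_summable p (E : preTopologicalLmodType K)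
    (chi : nat -> topdual E) :=
  forall x : E, ell_c0 p (fun n => modulus (chi n x)).

Definition weakly_null (E : preTopologicalLmodType K) (x : nat -> E) :=
  forall chi : topdual E, (fun n => chi (x n)) @ \oo --> (0 : K^o).

Definition weakstar_null (E : preTopologicalLmodType K)
    (chi : nat -> topdual E) :=
  forall x : E, (fun n => chi n x) @ \oo --> (0 : K^o).

(* The supremum over A is required to be finite: [sup] is 0 by convention on
   sets that are not bounded above. *)
Definition limited_set q' q (E : preTopologicalLmodType K) (A : set E) :=
  A !=set0 /\
  forall chi : nat -> topdual E, weakstar_p_summable q' chi ->
    (forall n, has_ubound [set modulus (chi n a) | a in A]) /\
    ell_c0 q (fun n => sup [set modulus (chi n a) | a in A]).

Section maps.
Variables E L : preTopologicalLmodType K.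
Implicit Type T : {linear E -> L}.

Definition weakly_p_convergent p T :=
  forall (eta : nat -> topdual L) (x : nat -> E),
    weakly_null (eta : nat -> strong_dual L) -> weakly_p_summable p x ->
    (fun n => eta n (T (x n))) @ \oo --> (0 : K^o).

Definition weakstar_p_convergent p T :=
  forall (eta : nat -> topdual L) (x : nat -> E),
    weakstar_null eta -> weakly_p_summable p x ->
    (fun n => eta n (T (x n))) @ \oo --> (0 : K^o).

Definition limited_p_convergent q' q p T :=
  forall x : nat -> E, weakly_p_summable p x -> limited_set q' q (range x) ->
    T \o x @ \oo --> (0 : L).

End maps.

Definition contains_linfty (L : preTopologicalLmodType K) :=
  exists (J : {linear linfty R k -> L}) (J' : L -> linfty R k),
    [/\ continuous J, cancel J J' & {within range J, continuous J'}].

End locally_convex.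

(* Main.v *)
From HB Require Import structures.
Require Import Defs.
From mathcomp Require Import all_boot all_order all_algebra.
From mathcomp Require Import all_classical all_reals all_analysis.
From mathcomp.real_closed Require Import complex.
From mathcomp Require Import ring lra.

Set Implicit Arguments.
Unset Strict Implicit.
Unset Printing Implicit Defensive.

Import Order.TTheory GRing.Theory Num.Theory.
Import numFieldNormedType.Exports.
Local Open Scope classical_set_scope.
Local Open Scope ring_scope.

(** Two implications are soft.  If the identity of [E] has the property, so does
    every continuous [T], which preserves limits.  And a weakly null sequence of
    the strong dual is weak* null because evaluations are continuous there, so
    that a weak* [p]-convergent operator is weakly [p]-convergent
    ([weakstar_p_convergent_weakly]).

    The content is that if some weakly [p]-summable sequence [x] does not tend
    to [0] in [E], there is a weak* [p]-convergent operator which still sees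
    this.  Some continuous seminorm is at least [1] on infinitely many terms of
    [x], and the Hahn-Banach theorem gives functionals [chi n] below that
    seminorm which attain it at [x n].  They are the coordinates of an operator
    from [E] to [linfty] that does not map [x] to a null sequence
    ([norming_operator]), and composing it with the embedding of [linfty] into
    [L] changes nothing ([linfty_embedding_cvg0]).

    Every operator factoring through [linfty] is weak* [p]-convergent
    ([factor_weakstar_p_convergent]), because in [linfty] weak* null sequences
    [mu] of functionals and weakly null sequences [z] satisfy
    [mu n (z n) -> 0] ([linfty_limited_weakly_null]): [linfty] is a Grothendieck
    space with the Dunford-Pettis property.  Both properties are obtained
    together, from the absolute masses of the [mu n], seen as finitely additive
    measures on [nat].  By Rosenthal's lemma these masses tend to [0] uniformly
    on disjoint sequences of sets ([phillips]).  So if the sets [A n] on which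
    [z n] is large keep a fixed mass for [mu n], they cannot be made disjoint
    along a subsequence, and infinitely many of them have the finite
    intersection property ([frequent_chain]).  An ultrafilter limit of point
    evaluations in these intersections is a functional that does not tend to
    [0] on [z]. *)

(** * Scalars and limits along ultrafilters *)

Section scalars.
Context {R : realType} {k : scalar_kind}.
Local Notation K := (scalar_field R k).
Implicit Types (a b : K) (r : R) (u v : nat -> K).

Lemma of_real1 : of_real R k 1 = 1.
Proof. by case: k. Qed.

Lemma of_realN r : of_real R k (- r) = - of_real R k r.
Proof. by case: k => //=; rewrite rmorphN. Qed.

Lemma modulus_of_real r : modulus (of_real R k r) = `|r|.
Proof.
by case: k => [//|]; rewrite /modulus normc_def /= expr0n addr0 sqrtr_sqr.
Qed.

Lemma modulus1 : modulus (1 : K) = 1.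
Proof. by rewrite -of_real1 modulus_of_real normr1. Qed.

Lemma modulusN a : modulus (- a) = modulus a.
Proof. by apply: (@of_real_inj R k); rewrite !of_real_modulus normrN. Qed.

Lemma modulusBC a b : modulus (a - b) = modulus (b - a).
Proof. by rewrite -modulusN opprB. Qed.

Lemma modulus_sum (I : Type) (s : seq I) (F : I -> K) :
  modulus (\sum_(i <- s) F i) <= \sum_(i <- s) modulus (F i).
Proof.
elim/big_rec2 : _ => [|i x y _ h]; first by rewrite modulus0.
by rewrite (le_trans (modulusD _ _))// lerD2l.
Qed.

Lemma ltr_of_real r r' : (of_real R k r < of_real R k r') = (r < r').
Proof. by rewrite !lt_neqAle ler_of_real (inj_eq (@of_real_inj R k)). Qed.

Lemma of_real_gt0 r : (0 < of_real R k r) = (0 < r).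
Proof. by rewrite -(@of_real0 R k) ltr_of_real. Qed.

(** A positive complex number is real, since the order only compares numbers
    with equal imaginary parts; radii in the scalar field can thus be replaced
    by real ones. *)
Lemma of_real_modulus_gt0 a : 0 < a -> a = of_real R k (modulus a).
Proof. by move=> a0; rewrite of_real_modulus gtr0_norm. Qed.

Lemma modulus_gt0 a : 0 < a -> 0 < modulus a.
Proof. by move=> a0; rewrite -of_real_gt0 -of_real_modulus_gt0. Qed.

(** A rotation to the positive half-line: it turns bounds on real parts into
    bounds on moduli. *)
Lemma phase_ex a :
  exists2 c : K, modulus c = 1 & c * a = of_real R k (modulus a).
Proof.
have [->|a0] := eqVneq a 0.
  by exists 1; [exact: modulus1|rewrite mulr0 modulus0 of_real0].
exists (`|a| / a); last by rewrite divfK// of_real_modulus.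
apply: (@of_real_inj R k); rewrite of_real_modulus of_real1 normf_div normr_id.
by rewrite divff// normr_eq0.
Qed.

Lemma cvg0_modulusP T (F : set_system T) (FF : Filter F) (u : T -> K^o) :
  u @ F --> (0 : K^o) <->
  forall e : R, 0 < e -> \forall x \near F, modulus (u x) < e.
Proof.
split=> [/cvgr0Pnorm_lt u0 e e0|u0].
  have := u0 (of_real R k e); rewrite of_real_gt0 => /(_ e0).
  by apply: filterS => x; rewrite -ltr_of_real of_real_modulus.
apply/cvgr0Pnorm_lt => e e0; have := u0 _ (modulus_gt0 e0).
apply: filterS => x.
by rewrite -ltr_of_real of_real_modulus -(of_real_modulus_gt0 e0).
Qed.

End scalars.

Section ultralimits.
Context {R : realType}.
Variables (W : set_system nat) (WU : UltraFilter W).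

(** A cluster point in the compact interval from [- C] to [C] is a limit, because
    an ultrafilter contains each set or its complement. *)
Lemma ultralimit_real (u : nat -> R) (C : R) : (forall n, `|u n| <= C) ->
  exists l, forall e, 0 < e -> W [set n | `|u n - l| < e].
Proof.
move=> uC.
have [|l [_ ul]] := @segment_compact R (- C) C (u @ W) _.
  apply: (@filterS _ W _ setT); last exact: filterT.
  by move=> n _; rewrite /preimage/= in_itv/= -ler_norml.
exists l => e e0.
have [//|nW] := in_ultra_setVsetC [set n | `|u n - l| < e] WU.
have [|_ [[n /= nle <-] /=]] := ul (u @` [set n | ~ `|u n - l| < e]) _ _
    (nbhsx_ballx l e e0).
  by apply: (@filterS _ W _ _ _ _ nW) => n /= h; exists n.
by rewrite -ball_normE /= distrC.
Qed.

Lemma ultralimit_ex {k : scalar_kind} (u : nat -> scalar_field R k) (C : R) :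
  (forall n, modulus (u n) <= C) ->
  exists l, forall e, 0 < e -> W [set n | modulus (u n - l) < e].
Proof.
case: k u => [u uC|u uC]; first exact: ultralimit_real uC.
have sq (x y : R) : `|x| <= Num.sqrt (x ^+ 2 + y ^+ 2).
  by rewrite -sqrtr_sqr ler_sqrt ?lerDl ?addr_ge0 ?sqr_ge0.
have modE (z : R[i]%C) : @modulus R ComplexScalars z =
    Num.sqrt (complex.Re z ^+ 2 + complex.Im z ^+ 2).
  by case: z => x y; rewrite /modulus normc_def.
have [|a ua] := @ultralimit_real (fun n => complex.Re (u n)) C.
  by move=> n; rewrite (le_trans _ (uC n))// modE sq.
have [|b ub] := @ultralimit_real (fun n => complex.Im (u n)) C.
  by move=> n; rewrite (le_trans _ (uC n))// modE addrC sq.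
exists (a +i* b)%C => e e0.
have e2 : 0 < e / 2 by rewrite divr_gt0.
apply: filterS2 (ua _ e2) (ub _ e2) => n; rewrite /mkset modE.
case: (u n) => x y /= xa yb.
have -> : e = Num.sqrt (e ^+ 2) by rewrite sqrtr_sqr gtr0_norm.
rewrite ltr_sqrt ?exprn_gt0//.
rewrite -(real_normK (num_real (x - a))) -(real_normK (num_real (y - b))).
have := normr_ge0 (x - a); have := normr_ge0 (y - b); nra.
Qed.

End ultralimits.

(** * Generalized limits and functionals on bounded sequences *)

Lemma free_ultrafilter_ex : exists W : set_system nat,
  UltraFilter W /\ \oo `<=` W.
Proof. exact: ultraFilterLemma. Qed.

Definition free_ultrafilter := projT1 (cid free_ultrafilter_ex).

#[global] Instance free_ultrafilterP : UltraFilter free_ultrafilter.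
Proof. by rewrite /free_ultrafilter; case: cid => ? []. Qed.

Lemma free_ultrafilter_ge n : free_ultrafilter [set m | (n <= m)%N].
Proof.
have [_] := projT2 (cid free_ultrafilter_ex); apply.
exact: nbhs_infty_ge.
Qed.

Section generalized_limit.
Context {R : realType} {k : scalar_kind}.
Local Notation K := (scalar_field R k).
Implicit Types (a : K) (u v : nat -> K) (c e : R).

Lemma modulus_small_eq0 a : (forall e, 0 < e -> modulus a < e) -> a = 0.
Proof.
move=> h; apply: modulus_eq0; apply/le_anti; rewrite modulus_ge0 andbT.
by rewrite leNgt; apply/negP => /h; rewrite ltxx.
Qed.

Definition bounded_scalars u := exists C, forall n, modulus (u n) <= C.

Definition null_scalars u :=
  forall e, 0 < e -> exists N, forall n, (N <= n)%N -> modulus (u n) < e.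

Lemma null_scalars_bounded u : null_scalars u -> bounded_scalars u.
Proof.
move=> /(_ 1 ltr01)[N h]; exists (1 + \sum_(i < N) modulus (u i)) => n.
have [/h nN|nN] := leqP N n.
  rewrite (le_trans (ltW nN))// lerDl sumr_ge0// => i _; exact: modulus_ge0.
rewrite (bigD1 (Ordinal nN))//= addrCA lerDl addr_ge0// sumr_ge0// => i _.
exact: modulus_ge0.
Qed.

(** The limit along a free ultrafilter, a junk value on unbounded sequences.
    On bounded sequences it is linear and always exists; it serves both to
    build elements of [linfty] coordinatewise and to build functionals. *)
Definition ulim u : K := xget 0
  [set l | forall e, 0 < e -> free_ultrafilter [set n | modulus (u n - l) < e]].

Lemma ulim_near u : bounded_scalars u -> forall e, 0 < e ->
  free_ultrafilter [set n | modulus (u n - ulim u) < e].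
Proof.
move=> [C /(ultralimit_ex free_ultrafilterP)[l ul]].
by rewrite /ulim; case: xgetP => // /(_ l).
Qed.

Lemma ulim_dist_le u a c : bounded_scalars u ->
  free_ultrafilter [set n | modulus (u n - a) <= c] ->
  modulus (ulim u - a) <= c.
Proof.
move=> bu uc; apply/ler_addgt0Pl => e e0.
have [n [/= un una]] := filter_ex (filterI (ulim_near bu e0) uc).
rewrite -(subrK (u n) (ulim u)) -addrA (le_trans (modulusD _ _))//.
by rewrite lerD// modulusBC ltW.
Qed.

Lemma ulim_ge u c : bounded_scalars u ->
  free_ultrafilter [set n | c <= modulus (u n)] -> c <= modulus (ulim u).
Proof.
move=> bu uc; apply/ler_addgt0Pl => e e0.
have [n [/= un una]] := filter_ex (filterI (ulim_near bu e0) uc).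
rewrite (le_trans una)// -(subrK (ulim u) (u n)) (le_trans (modulusD _ _))//.
by rewrite lerD// ltW.
Qed.

Lemma ulim_linear a u v : bounded_scalars u -> bounded_scalars v ->
  ulim (fun n => a * u n + v n) = a * ulim u + ulim v.
Proof.
move=> bu bv; have bw : bounded_scalars (fun n => a * u n + v n).
  move: bu bv => [C uC] [D vD]; exists (modulus a * C + D) => n.
  by rewrite (le_trans (modulusD _ _))// lerD// modulusM ler_wpM2l ?modulus_ge0.
apply/eqP; rewrite -subr_eq0; apply/eqP/modulus_small_eq0 => e e0.
have a1 : 0 < modulus a + 1 by rewrite ltr_wpDl ?modulus_ge0.
have e2 : 0 < e / 2 by rewrite divr_gt0.
have ea : 0 < e / 2 / (modulus a + 1) by rewrite divr_gt0.
apply: (@le_lt_trans _ _ (e / 2)); last by rewrite gtr_pMr// invf_lt1// ltr1n.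
apply: ulim_dist_le => //.
have e4 : 0 < e / 4 by rewrite divr_gt0.
have ea4 : 0 < e / 4 / (modulus a + 1) by rewrite divr_gt0.
apply: filterS2 (ulim_near bu ea4) (ulim_near bv e4) => n /= un vn.
have -> : a * u n + v n - (a * ulim u + ulim v) =
    a * (u n - ulim u) + (v n - ulim v).
  by rewrite mulrBr opprD addrACA.
rewrite (le_trans (modulusD _ _))// modulusM.
have : modulus a * modulus (u n - ulim u) <= e / 4.
  have := ltW un; rewrite ler_pdivlMr// => h.
  by apply: le_trans h; rewrite mulrDr mulrC lerDl mulr1 modulus_ge0.
by lra.
Qed.

End generalized_limit.

Section linfty_functionals.
Context {R : realType} {k : scalar_kind}.
Local Notation K := (scalar_field R k).
Local Notation linfty := (linfty R k).
Implicit Types (f g : linfty) (mu : linfty -> K) (A B : set nat).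

Lemma linfty_build (u : nat -> K) (C : R) : (forall n, modulus (u n) <= C) ->
  exists2 f : linfty, (forall n, f n = u n) & sup_norm f <= C.
Proof.
move=> uC; have ub : (u : nat -> K^o) \in bounded_seq.
  by apply/asboolP; exists C => _ [n _ <-].
by exists (Linfty ub) => //; exact: sup_norm_le.
Qed.

Lemma linftyZE (a : K) f n : (a *: f) n = a * f n.
Proof. by []. Qed.

Lemma linftyBE f g n : (f - g) n = f n - g n.
Proof. by []. Qed.

Lemma linftyDE f g n : (f + g) n = f n + g n.
Proof. by []. Qed.

Lemma linfty_eq f g : (forall n, f n = g n) -> f = g.
Proof. by move=> fg; apply/val_inj/funext. Qed.

Definition linfty_functional mu :=
  (forall (a : K) f g, mu (a *: f + g) = a * mu f + mu g) /\
  exists C, forall f, modulus (mu f) <= C * sup_norm f.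

Lemma sup_norm_ge0 f : 0 <= sup_norm f.
Proof. exact: le_trans (modulus_ge0 _) (modulus_le_sup_norm f 0%N). Qed.

Section theory.
Variables (mu : linfty -> K).
Hypothesis muP : linfty_functional mu.

Lemma functional0 : mu 0 = 0.
Proof.
have := muP.1 0 0 0; rewrite scale0r mul0r addr0 add0r => h.
by have := muP.1 (-1) 0 0; rewrite scaleN1r mulN1r addNr addNr.
Qed.

Lemma functionalZ (a : K) f : mu (a *: f) = a * mu f.
Proof. by have := muP.1 a f 0; rewrite functional0 !addr0. Qed.

Lemma functionalD f g : mu (f + g) = mu f + mu g.
Proof. by have := muP.1 1 f g; rewrite scale1r mul1r. Qed.

Lemma functionalB f g : mu (f - g) = mu f - mu g.
Proof. by rewrite functionalD -scaleN1r functionalZ mulN1r. Qed.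

(** By rotation, a functional is normed by elements with positive values. *)
Lemma functional_phase f :
  exists2 c : K, modulus c = 1 & mu (c *: f) = of_real R k (modulus (mu f)).
Proof. by have [c c1 cE] := phase_ex (mu f); exists c; rewrite ?functionalZ. Qed.

End theory.

Definition unit_on A f :=
  (forall n, modulus (f n) <= 1) /\ (forall n, ~ A n -> f n = 0).

(** The total variation over [A] of [mu], seen as a finitely additive measure
    on the subsets of [nat]. *)
Definition absmass mu A := sup [set modulus (mu f) | f in unit_on A].

Section absmass.
Variables (mu : linfty -> K).
Hypothesis muP : linfty_functional mu.

Lemma unit_on_sup_norm A f : unit_on A f -> sup_norm f <= 1.
Proof. by case=> f1 _; exact: sup_norm_le. Qed.

Lemma unit_on0 A : unit_on A 0.
Proof. by split=> [n|//]; rewrite modulus0. Qed.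

Lemma unit_onS A B f : A `<=` B -> unit_on A f -> unit_on B f.
Proof. by move=> AB [f1 f0]; split => // n Bn; apply: f0 => /AB. Qed.

Lemma unit_onZ A f (c : K) : modulus c <= 1 -> unit_on A f -> unit_on A (c *: f).
Proof.
move=> c1 [f1 f0]; split=> n.
  by rewrite linftyZE modulusM mulr_ile1 ?modulus_ge0 ?f1.
by move=> An; rewrite linftyZE f0// mulr0.
Qed.

Lemma absmass_has_sup A : has_sup [set modulus (mu f) | f in unit_on A].
Proof.
split; first by exists (modulus (mu 0)), 0 => //; exact: unit_on0.
have [_ [C muC]] := muP; exists `|C| => _ [f fA <-].
rewrite (le_trans (muC f))// (le_trans (ler_norm _))// normrM.
rewrite (ger0_norm (sup_norm_ge0 f)) ler_piMr//; exact: unit_on_sup_norm fA.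
Qed.

Lemma modulus_le_absmass A f : unit_on A f -> modulus (mu f) <= absmass mu A.
Proof.
by move=> fA; apply: ub_le_sup; [case: (absmass_has_sup A)|exists f].
Qed.

Lemma absmass_le A c : (forall f, unit_on A f -> modulus (mu f) <= c) ->
  absmass mu A <= c.
Proof.
move=> h; apply: ge_sup; first by case: (absmass_has_sup A).
by move=> _ [f fA <-]; exact: h.
Qed.

Lemma absmass_ge0 A : 0 <= absmass mu A.
Proof. exact: le_trans (modulus_ge0 _) (modulus_le_absmass (unit_on0 A)). Qed.

Lemma absmass_set0 : absmass mu set0 <= 0.
Proof.
apply: absmass_le => f [_ f0].
suff -> : f = 0 by rewrite (functional0 muP) modulus0.
by apply: linfty_eq => n; rewrite f0//; case.
Qed.

Lemma le_absmass A B : A `<=` B -> absmass mu A <= absmass mu B.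
Proof.
move=> AB; apply: absmass_le => f fA; apply: modulus_le_absmass.
exact: unit_onS fA.
Qed.

Lemma absmass_approx A c : c < absmass mu A ->
  exists2 f, unit_on A f & exists2 r, c < r & mu f = of_real R k r.
Proof.
move=> cA; have [_ [f fA <-] cf] := sup_gt (absmass_has_sup A).1 cA.
have [b b1 bE] := functional_phase muP f.
exists (b *: f); last by exists (modulus (mu f)).
by apply: unit_onZ => //; rewrite b1.
Qed.

Lemma restrict_ex A f : exists2 g : linfty,
  (forall n, A n -> g n = f n) & (forall n, ~ A n -> g n = 0).
Proof.
have [|g gE _] := @linfty_build
    (fun n => if `[< A n >] then f n else 0) (sup_norm f).
  by move=> n; case: ifP; rewrite ?modulus0 ?sup_norm_ge0 ?modulus_le_sup_norm.
exists g => n An; rewrite gE; first by rewrite (asboolT An).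
by rewrite (asboolF An).
Qed.

Lemma absmassU_le A B :
  absmass mu (A `|` B) <= absmass mu A + absmass mu B.
Proof.
apply: absmass_le => f [f1 f0].
have [g gA g0] := restrict_ex A f.
have gE : f = g + (f - g) by rewrite addrC subrK.
rewrite gE (functionalD muP) (le_trans (modulusD _ _))// lerD//.
  apply: modulus_le_absmass; split=> // n.
  by have [/gA ->//|/g0 ->] := pselect (A n); rewrite modulus0.
apply: modulus_le_absmass; split=> n; rewrite linftyBE.
  have [/gA ->|/g0 ->] := pselect (A n); last by rewrite subr0.
  by rewrite subrr modulus0.
have [/gA -> _|/[dup] An /g0 -> Bn] := pselect (A n); first by rewrite subrr.
by rewrite subr0 f0// => -[].
Qed.

(** Positive values of norming elements with disjoint supports add up. *)
Lemma absmassU_ge A B : A `&` B = set0 ->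
  absmass mu A + absmass mu B <= absmass mu (A `|` B).
Proof.
move=> AB0; apply/ler_addgt0Pl => e e0.
have e2 : 0 < e / 2 by rewrite divr_gt0.
have [|f fA [r fr muf]] := @absmass_approx A (absmass mu A - e / 2).
  by rewrite ltrBlDr ltrDl.
have [|g gB [s gs mug]] := @absmass_approx B (absmass mu B - e / 2).
  by rewrite ltrBlDr ltrDl.
suff : r + s <= absmass mu (A `|` B) by lra.
rewrite (le_trans (ler_norm _))// -(@modulus_of_real R k) of_realD -muf -mug.
rewrite -(functionalD muP); apply: modulus_le_absmass; split=> n.
  rewrite linftyDE; have [An|nAn] := pselect (A n).
    rewrite gB.2 ?addr0 ?fA.1// => Bn.
    by move: AB0; rewrite -subset0 => /(_ n); apply.
  by rewrite fA.2// add0r gB.1.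
by move=> nAB; rewrite linftyDE fA.2 ?gB.2 ?addr0// => ?; apply: nAB; [right|left].
Qed.

Lemma modulus_le_absmass_sup_norm A f c : (forall n, modulus (f n) <= c) ->
  (forall n, ~ A n -> f n = 0) -> modulus (mu f) <= absmass mu A * c.
Proof.
move=> fc f0; have : 0 <= c by exact: le_trans (modulus_ge0 _) (fc 0%N).
rewrite le_eqVlt => /predU1P[c0|c0].
  suff -> : f = 0 by rewrite (functional0 muP) modulus0 -c0 mulr0.
  by apply: linfty_eq => n; apply/modulus_eq0/le_anti; rewrite modulus_ge0 andbT c0 fc.
have cu : of_real R k c != 0.
  by rewrite -(@of_real0 R k) (inj_eq (@of_real_inj R k)) gt_eqF.
have mc : modulus ((of_real R k c)^-1) = c^-1.
  apply: (mulfI (lt0r_neq0 c0)); rewrite divff ?lt0r_neq0//.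
  rewrite -{1}(gtr0_norm c0) -(@modulus_of_real R k) -modulusM divff//.
  exact: modulus1.
have fE : f = of_real R k c *: ((of_real R k c)^-1 *: f).
  by rewrite scalerA divff// scale1r.
rewrite fE (functionalZ muP) modulusM modulus_of_real gtr0_norm// mulrC.
rewrite ler_pM2r//; apply: modulus_le_absmass; split=> n.
  rewrite modulusM mc mulrC ler_pdivrMr// mul1r; exact: fc.
by move=> /f0 fn; rewrite linftyZE fn mulr0.
Qed.

End absmass.
End linfty_functionals.

(** * Uniform boundedness, Rosenthal's lemma and Phillips' lemma *)

Section uniform_boundedness.
Context {R : realType} {k : scalar_kind}.
Local Notation K := (scalar_field R k).
Local Notation linfty := (linfty R k).
Implicit Types (f g x : linfty) (mu : linfty -> K) (r : R).

(** Of the two perturbations [x + h] and [x - h] by a nearly norming element [h]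
    of norm at most [r], one has a value at least as large as that of [h]. *)
Lemma functional_perturb mu x r : linfty_functional mu -> 0 < r ->
  0 < absmass mu setT ->
  exists2 x' : linfty, (forall i, modulus (x' i - x i) <= r) &
              2 / 3 * r * absmass mu setT <= modulus (mu x').
Proof.
move=> muP r0 V0.
have [|f [f1 _] [s Vs muf]] :=
    @absmass_approx _ _ _ muP setT (2 / 3 * absmass mu setT); first by lra.
have s0 : 0 < s by apply: le_lt_trans Vs; rewrite mulr_ge0 ?ltW// divr_ge0.
pose h := of_real R k r *: f.
have muh : mu h = of_real R k (r * s).
  by rewrite (functionalZ muP) muf -of_realM.
have hr i : modulus (h i) <= r.
  by rewrite linftyZE modulusM modulus_of_real gtr0_norm// ger_pMr.
have rs : 2 / 3 * r * absmass mu setT <= r * s.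
  by rewrite mulrAC mulrC ler_pM2l// ltW.
have : r * s + r * s <= modulus (mu (x + h)) + modulus (mu (x - h)).
  rewrite (le_trans _ (le_trans (modulusD (mu (x + h)) (- mu (x - h))) _))//.
    have -> : mu (x + h) + - mu (x - h) = mu h + mu h.
      rewrite (functionalD muP) (functionalB muP) opprB.
      by rewrite addrAC addrCA subrr addr0.
    by rewrite muh -of_realD modulus_of_real ler_norm.
  by rewrite modulusN.
have [h1 _|h1 h2] := leP (r * s) (modulus (mu (x + h))).
  exists (x + h); last exact: le_trans h1.
  by move=> i; rewrite linftyDE [x i + _]addrC addrK.
exists (x - h); last by lra.
by move=> i; rewrite linftyBE [x i - _]addrC addrK modulusN.
Qed.

(** A gliding hump: an unbounded sequence of norms allows steps of sizes
    [3 ^- j], the [j]-th one making the [j]-th selected functional large, while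
    all later steps together are half as long and cannot undo this. *)
Lemma uniform_boundedness (mu : nat -> linfty -> K) :
  (forall n, linfty_functional (mu n)) ->
  (forall f, bounded_scalars (mu^~ f)) ->
  exists C, forall n, absmass (mu n) setT <= C.
Proof.
move=> muP mub; apply: contrapT => /forallNP unb.
pose r (j : nat) : R := 3^-1 ^+ j.
have r0 j : 0 < r j by rewrite exprn_gt0.
have rS j : r j.+1 = r j / 3 by rewrite /r exprSr.
(* the [j]-th step gains [2 / 3 * r j] times the norm, the later ones lose at
   most [1 / 2 * r j] times the norm, and [2 / 3 - 1 / 2 = 1 / 6] *)
have /choice[nn nnP] : forall j : nat, exists n,
    6 * j%:R / r j < absmass (mu n) setT.
  move=> j; have /existsNP[n /negP] := unb (6 * j%:R / r j).
  by rewrite -ltNge; exists n.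
have /choice[next nextP] (xj : linfty * nat) : exists x' : linfty,
    (forall i, modulus (x' i - xj.1 i) <= r xj.2) /\
    2 / 3 * r xj.2 * absmass (mu (nn xj.2)) setT <= modulus (mu (nn xj.2) x').
  have [|x'] := functional_perturb xj.1 (muP (nn xj.2)) (r0 xj.2) _.
    by apply: le_lt_trans (nnP _); rewrite divr_ge0 ?mulr_ge0// ltW.
  by exists x'.
pose x := fix x j := if j is j'.+1 then next (x j', j') else 0.
have xS j i : modulus (x j.+1 i - x j i) <= r j.
  by have [+ _] := nextP (x j, j); apply.
have xtail j d i :
    modulus (x (j.+1 + d)%N i - x j.+1 i) <= (r j - r (j + d)%N) / 2.
  elim: d => [|d IH]; first by rewrite !addn0 !subrr modulus0 mul0r.
  rewrite !addnS -(subrK (x (j.+1 + d)%N i) (x _ i)) -addrA.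
  rewrite (le_trans (modulusD _ _))// rS.
  have := xS (j.+1 + d)%N i; rewrite addSn rS => h.
  by move: IH; rewrite addSn => IH; lra.
have xtail' j m i : (j < m)%N -> modulus (x m i - x j.+1 i) <= r j / 2.
  move=> jm; rewrite -(subnKC jm) (le_trans (xtail _ _ _))//.
  by rewrite ler_pM2r// lerBlDr lerDl ltW.
have xb i : bounded_scalars (fun m => x m i).
  exists (modulus (x 1%N i) + r 0%N / 2 + modulus (x 0%N i)) => -[|m].
    by rewrite lerDr addr_ge0 ?modulus_ge0// divr_ge0// ltW.
  rewrite -(subrK (x 1%N i) (x m.+1 i)) (le_trans (modulusD _ _))//.
  have := xtail' 0%N m.+1 i isT; have := modulus_ge0 (x 0%N i); lra.
have ylim j i : modulus (ulim (fun m => x m i) - x j.+1 i) <= r j / 2.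
  apply: ulim_dist_le => //.
  by apply: filterS (free_ultrafilter_ge j.+1) => m /=; exact: xtail'.
have [|y yE _] := @linfty_build _ _ (fun i => ulim (fun m => x m i))
    (sup_norm (x 1%N) + r 0%N / 2).
  move=> i; rewrite -(subrK (x 1%N i) (ulim _)) (le_trans (modulusD _ _))//.
  by rewrite addrC lerD// modulus_le_sup_norm.
have [C yC] := mub y.
have muy j : j%:R <= modulus (mu (nn j) y).
  have [_ /=] := nextP (x j, j); rewrite -/(x j.+1) => h.
  have hy : modulus (mu (nn j) (y - x j.+1)) <=
      absmass (mu (nn j)) setT * (r j / 2).
    apply: modulus_le_absmass_sup_norm => // [i|i /(_ I)//].
    by rewrite linftyBE yE.
  have : modulus (mu (nn j) (x j.+1)) <=
      modulus (mu (nn j) (y - x j.+1)) + modulus (mu (nn j) y).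
    rewrite (functionalB (muP _)) modulusBC.
    by rewrite -[X in modulus X <= _](subrK (mu (nn j) y)) modulusD.
  have := nnP j; rewrite ltr_pdivrMr// => hV.
  move: h hy hV; set V := absmass _ _; set p := modulus _.
  by set q := modulus _; set t := modulus _; lra.
have := muy (Num.bound `|C|); have := yC (nn (Num.bound `|C|)).
move=> h1 h2; have := le_trans h2 h1; rewrite leNgt => /negP; apply.
by rewrite (le_lt_trans (ler_norm C))// archi_boundP.
Qed.

End uniform_boundedness.

(** Rosenthal's lemma for superadditive set functions with a common bound.
    If no subsequence works, split [nat] into infinitely many infinite classes;
    each class contains an index whose mass on the rest of its class exceeds
    [d], and along these indices the mass of the union has dropped by [d].  The
    integer [m] bounds how often this can happen. *)
Lemma rosenthal (R : realType) (d : R) (m : nat) :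
  forall (V : nat -> set nat -> R) (B : nat -> set nat),
  (forall n A A', A `<=` A' -> V n A <= V n A') ->
  (forall n A A', A `&` A' = set0 -> V n A + V n A' <= V n (A `|` A')) ->
  (forall i j, i <> j -> B i `&` B j = set0) ->
  (forall n, V n (\bigcup_j B j) <= m%:R * d) ->
  0 <= d ->
  exists2 s : nat -> nat, injective s &
    forall i, V (s i) (\bigcup_(j in [set j | j <> i]) B (s j)) <= d.
Proof.
elim: m => [|m IH] V B Vle Vadd Bdisj Vd d0.
  exists id => [//|i]; apply: le_trans d0; have := Vd i; rewrite mul0r.
  by apply: le_trans; apply: Vle => x [j _ Bx]; exists j.
pose e (i a : nat) : nat := pickle (i, a).
have einj i a i' a' : e i a = e i' a' -> (i, a) = (i', a').
  by move=> h; apply: (pcan_inj (@pickleK _)).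
have [[i ei]|/forallNP ne] := pselect (exists i, forall a,
    V (e i a) (\bigcup_(b in [set b | b <> a]) B (e i b)) <= d).
  by exists (e i) => // a a' /einj[].
have /choice[a aP] : forall i, exists a,
    d < V (e i a) (\bigcup_(b in [set b | b <> a]) B (e i b)).
  by move=> i; have /existsNP[a /negP] := ne i; rewrite -ltNge; exists a.
pose t i := e i (a i).
have tinj : injective t by move=> i i' /einj[].
have [||||//|s sinj sP] := IH (V \o t) (B \o t).
- by move=> n A A'; exact: Vle.
- by move=> n A A'; exact: Vadd.
- by move=> i j ij; apply: Bdisj => /tinj.
- move=> n /=.
  pose rest := \bigcup_(b in [set b | b <> a n]) B (e n b).
  have := Vadd (t n) rest (\bigcup_j B (t j)).
  (* the class of [n] meets the range of [t] in [t n] only *)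
  have -> : rest `&` \bigcup_j B (t j) = set0.
    rewrite -subset0 => x [[b /= ba Bb] [j _ Bj]].
    have := Bdisj (e n b) (t j).
    rewrite -subset0 => /(_ _ x); apply=> // /einj[nj].
    by rewrite nj in ba *.
  move=> /(_ erefl) h.
  have : V (t n) (rest `|` \bigcup_j B (t j)) <= m.+1%:R * d.
    apply: le_trans (Vd (t n)); apply: Vle => x [[b _ Bx]|[j _ Bx]].
      by exists (e n b).
    by exists (t j).
  by have := aP n; rewrite -natr1 mulrDl mul1r -/(t n) -/rest; move: h; lra.
exists (t \o s) => [|i]; first exact: inj_comp.
exact: sP.
Qed.

Lemma injective_unbounded (s : nat -> nat) : injective s ->
  forall N, exists i, (N <= s i)%N.
Proof.
move=> sinj N; apply: contrapT => /forallNP h.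
have hs (i : 'I_N.+1) : (s i < N)%N by rewrite ltnNge; apply/negP/h.
have /leq_card : injective (fun i : 'I_N.+1 => Ordinal (hs i)).
  by move=> i j /(congr1 val)/= /sinj/val_inj.
by rewrite !card_ord ltnn.
Qed.

Section phillips.
Context {R : realType} {k : scalar_kind}.
Local Notation K := (scalar_field R k).
Local Notation linfty := (linfty R k).
Implicit Types (f g x : linfty) (mu : nat -> linfty -> K).

(** The pointwise sum of the [g i]; it is bounded by [1] since at most one of
    them is nonzero at each index. *)
Lemma glue_disjoint (B : nat -> set nat) (g : nat -> linfty) :
  (forall i j, i <> j -> B i `&` B j = set0) ->
  (forall i, unit_on (B i) (g i)) ->
  exists x : linfty, forall i,
    unit_on (\bigcup_(j in [set j | j <> i]) B j) (x - g i).
Proof.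
move=> Bdisj gB.
have Buniq i j n : B i n -> B j n -> i = j.
  move=> Bi Bj; apply: contrapT => /Bdisj; rewrite -subset0 => /(_ n); exact.
have /choice[u uP] : forall n, exists a : K,
    [/\ modulus a <= 1, forall i, B i n -> a = g i n &
        (forall i, ~ B i n) -> a = 0].
  move=> n; have [[i Bi]|/forallNP nB] := pselect (exists i, B i n).
    exists (g i n); split; [exact: (gB i).1| |by move=> /(_ i)].
    by move=> j Bj; rewrite (Buniq _ _ _ Bi Bj).
  by exists 0; split=> [|i /nB//|//]; rewrite modulus0.
have [|x xE _] := @linfty_build _ _ u 1; first by move=> n; case: (uP n).
exists x => i; have gi n : ~ B i n -> g i n = 0 by exact: (gB i).2.
split=> n; rewrite linftyBE xE; have [u1 uB u0] := uP n.
  have [Bi|nBi] := pselect (B i n); last by rewrite gi// subr0.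
  by rewrite (uB i)// subrr modulus0.
move=> nB; have [Bi|nBi] := pselect (B i n); first by rewrite (uB i)// subrr.
rewrite gi// subr0 u0// => j Bj; have [ij|ij] := eqVneq j i.
  by rewrite ij in Bj.
by apply: nB; exists j => //; apply/eqP.
Qed.

Definition pointwise_null mu := forall f, null_scalars (mu^~ f).

(** Phillips' lemma: a weak* null sequence of finitely additive measures on
    [nat] is uniformly strongly additive.  Otherwise Rosenthal's lemma makes
    the masses nearly independent, and gluing norming functions of the disjoint
    sets gives one bounded sequence on which infinitely many of the measures
    stay away from zero. *)
Lemma phillips mu (B : nat -> set nat) (d : R) :
  (forall n, linfty_functional (mu n)) -> pointwise_null mu ->
  (forall i j, i <> j -> B i `&` B j = set0) -> 0 < d ->
  exists n, absmass (mu n) (B n) < d.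
Proof.
move=> muP mu0 Bdisj d0; apply: contrapT => /forallNP muB.
have dB n : d <= absmass (mu n) (B n) by rewrite leNgt; apply/negP/muB.
have [C muC] := uniform_boundedness muP (fun f => null_scalars_bounded (mu0 f)).
have d4 : 0 < d / 4 by rewrite divr_gt0.
have [|||||s sinj sP] := @rosenthal R (d / 4) (Num.bound (C / (d / 4)))
    (fun n => absmass (mu n)) B.
- by move=> n A A'; exact: le_absmass.
- by move=> n A A'; exact: absmassU_ge.
- exact: Bdisj.
- move=> n; rewrite -ler_pdivrMr// ltW// (le_lt_trans _ (archi_boundP _))//.
    rewrite ler_pM2r ?invr_gt0// (le_trans _ (muC n))//.
    by apply: le_absmass => // x.
  apply: divr_ge0; last exact: ltW.
  exact: le_trans (absmass_ge0 (muP 0%N) _) (muC 0%N).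
- exact: ltW.
have d2 i : d / 2 < absmass (mu (s i)) (B (s i)).
  by apply: lt_le_trans (dB (s i)); lra.
have /choice[g gP] : forall i, exists g, unit_on (B (s i)) g /\
    d / 2 < modulus (mu (s i) g).
  move=> i; have [g gB [r dr mug]] := absmass_approx (muP (s i)) (d2 i).
  exists g; split=> //; rewrite mug modulus_of_real (lt_le_trans dr)//.
  exact: ler_norm.
have [|i|x xg] := @glue_disjoint (B \o s) g.
- by move=> i j ij; apply: Bdisj => /sinj.
- exact: (gP i).1.
have [N xN] := mu0 x _ d4; have [i Ni] := injective_unbounded sinj N.
have := xN _ Ni; apply/negP; rewrite -leNgt.
have h1 := le_trans (modulus_le_absmass (muP (s i)) (xg i)) (sP i).
have [_ h2] := gP i.
have : modulus (mu (s i) (g i)) <=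
    modulus (mu (s i) (x - g i)) + modulus (mu (s i) x).
  rewrite (functionalB (muP _)) modulusBC.
  by rewrite -[X in modulus X <= _](subrK (mu (s i) x)) modulusD.
by move: h1 h2; set a := modulus _; set b := modulus _; set c := modulus _; lra.
Qed.

End phillips.

(** * Weakly null sequences of bounded sequences *)

Section weakly_null_sequences.
Context {R : realType} {k : scalar_kind}.
Local Notation K := (scalar_field R k).
Local Notation linfty := (linfty R k).
Implicit Types (b f g x y : linfty) (z : nat -> linfty).

Definition linfty_weakly_null z :=
  forall chi, linfty_functional chi -> null_scalars (fun n => chi (z n)).

Section pairing.
Variable jj : nat -> nat.

Definition pairing_sum b y (N : nat) : K :=
  \sum_(i < N) of_real R k (2^-1 ^+ i) * (b i * y (jj i)).

(** The series [\sum_i 2 ^- i * b i * y (jj i)].  For fixed [b] it is a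
    functional of [y], for fixed [y] a functional of [b]: it turns bounds along
    the dual of [linfty] into pointwise bounds on [linfty], where the uniform
    boundedness principle applies. *)
Definition pairing b y := ulim (pairing_sum b y).

Lemma pairing_sum_le b y N :
  modulus (pairing_sum b y N) <= 2 * (sup_norm b * sup_norm y).
Proof.
rewrite (le_trans (modulus_sum _ _))//.
have bnd (i : nat) : modulus (of_real R k (2^-1 ^+ i) * (b i * y (jj i))) <=
    2^-1 ^+ i * (sup_norm b * sup_norm y).
  rewrite !modulusM modulus_of_real ger0_norm ?exprn_ge0//.
  by rewrite ler_wpM2l ?exprn_ge0// ler_pM ?modulus_ge0 ?modulus_le_sup_norm.
rewrite (le_trans (ler_sum _ (fun (i : 'I_N) _ => bnd i)))//.
rewrite -mulr_suml ler_wpM2r ?mulr_ge0 ?sup_norm_ge0//.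
suff -> : \sum_(i < N) (2^-1 : R) ^+ i = 2 - 2 * 2^-1 ^+ N.
  by rewrite gerBl mulr_ge0 ?exprn_ge0.
elim: N => [|N IH]; first by rewrite big_ord0 expr0 mulr1 subrr.
by rewrite big_ord_recr/= IH exprS; lra.
Qed.

Lemma pairing_sum_bounded b y : bounded_scalars (pairing_sum b y).
Proof. by exists (2 * (sup_norm b * sup_norm y)) => N; exact: pairing_sum_le. Qed.

Lemma modulus_pairing_le b y :
  modulus (pairing b y) <= 2 * (sup_norm b * sup_norm y).
Proof.
rewrite -[pairing b y]subr0.
apply: ulim_dist_le; first exact: pairing_sum_bounded.
by apply: filterS filterT => N _ /=; rewrite subr0; exact: pairing_sum_le.
Qed.

Lemma pairing_functional_l y : linfty_functional (pairing^~ y).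
Proof.
split=> [a b b'|]; last first.
  exists (2 * sup_norm y) => b; rewrite -mulrA (mulrC (sup_norm y)).
  exact: modulus_pairing_le.
rewrite /pairing.
rewrite -(ulim_linear a (pairing_sum_bounded b y) (pairing_sum_bounded b' y)).
congr ulim; apply/funext => N; rewrite /pairing_sum mulr_sumr -big_split.
apply: eq_bigr => i _.
rewrite [RHS]/= linftyDE linftyZE mulrDl mulrDr; congr (_ + _).
by rewrite -mulrA mulrCA.
Qed.

Lemma pairing_functional_r b : linfty_functional (pairing b).
Proof.
split=> [a y y'|]; last first.
  by exists (2 * sup_norm b) => y; rewrite -mulrA; exact: modulus_pairing_le.
rewrite /pairing.
rewrite -(ulim_linear a (pairing_sum_bounded b y) (pairing_sum_bounded b y')).
congr ulim; apply/funext => N; rewrite /pairing_sum mulr_sumr -big_split.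
apply: eq_bigr => i _.
rewrite [RHS]/= linftyDE linftyZE !mulrDr; congr (_ + _).
by rewrite (mulrCA (b i)) [LHS]mulrCA.
Qed.

Lemma pairing_unit l b y : (forall i, b i = (i == l)%:R) ->
  2^-1 ^+ l * modulus (y (jj l)) <= modulus (pairing b y).
Proof.
move=> bE; apply: ulim_ge; first exact: pairing_sum_bounded.
apply: filterS (free_ultrafilter_ge l.+1) => N /= lN.
rewrite /pairing_sum (bigD1 (Ordinal lN))//= big1 ?addr0.
  rewrite bE eqxx mul1r modulusM modulus_of_real ger0_norm//; exact: exprn_ge0.
by move=> i il; rewrite bE -[_ == l]/(i == Ordinal lN) (negbTE il) mul0r mulr0.
Qed.

End pairing.

(** Were the norms unbounded, for each [i] some term [z n] would have a
    coordinate [jj i] of modulus above [4 ^ i].  The functionals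
    [pairing jj ^~ (z n)] for these [n] are pointwise bounded, each [pairing jj b]
    being bounded along [z], yet their norms are at least [2 ^ i]. *)
Lemma linfty_weakly_null_bounded z : linfty_weakly_null z ->
  exists D, forall n, sup_norm (z n) <= D.
Proof.
move=> z0; apply: contrapT => /forallNP unb.
(* [4 ^ i] beats the weight [2 ^- i] of the [i]-th term of the pairing *)
have /choice[nj njP] : forall i : nat, exists nj : nat * nat,
    4 ^+ i < modulus (z nj.1 nj.2).
  move=> i; have /existsNP[n zn] := unb (4 ^+ i); apply: contrapT => /forallNP h.
  by apply: zn; apply: sup_norm_le => j; rewrite leNgt; apply/negP/(h (n, j)).
pose jj i := (nj i).2.
have [||C muC] := @uniform_boundedness _ _ (fun i b => pairing jj b (z (nj i).1)).
- by move=> i; exact: pairing_functional_l.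
- move=> b; have [c bc] := null_scalars_bounded (z0 _ (pairing_functional_r jj b)).
  by exists c => i; exact: bc.
have C2 l : 2 ^+ l <= C.
  have [|b bE b1] := @linfty_build R k (fun i => (i == l)%:R) 1.
    by move=> i; case: (i == l); rewrite ?modulus1 ?modulus0.
  have bT : unit_on setT b.
    by split=> [n|n /(_ I)//]; rewrite (le_trans (modulus_le_sup_norm _ _)).
  apply: le_trans (muC l).
  apply: le_trans (modulus_le_absmass (pairing_functional_l jj _) bT).
  apply: le_trans (pairing_unit jj (z (nj l).1) bE).
  have := njP l; rewrite -/(jj l) => /ltW h.
  rewrite (le_trans _ (ler_wpM2l _ h)) ?exprn_ge0//.
  rewrite -exprMn (_ : 2^-1 * 4 = 2 :> R)//; lra.
have := C2 (Num.bound `|C|); rewrite leNgt => /negP; apply.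
rewrite (le_lt_trans (ler_norm C))// (lt_trans (archi_boundP (normr_ge0 C)))//.
by rewrite -natrX ltr_nat ltn_expl.
Qed.

End weakly_null_sequences.

Section recurrence.
Context {R : realType}.
Variables (V : nat -> set nat -> R) (A : nat -> set nat).
Hypothesis Vle : forall n B B', B `<=` B' -> V n B <= V n B'.
Hypothesis VU : forall n B B', V n (B `|` B') <= V n B + V n B'.
Hypothesis V0 : forall n, V n set0 <= 0.
Hypothesis Vdisjoint : forall (s : nat -> nat) (B : nat -> set nat) (d : R),
  (forall i, s i < s i.+1)%N -> (forall i j, i <> j -> B i `&` B j = set0) ->
  0 < d -> exists i, V (s i) (B i) < d.

Definition frequent (B : set nat) := exists2 c, 0 < c &
  forall N, exists2 n, (N <= n)%N & c <= V n (A n `&` B).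

Lemma frequent_nonempty B : frequent B -> B !=set0.
Proof.
move=> [c c0 /(_ 0%N)[n _ cV]]; apply/set0P/negP => /eqP B0.
by move: cV; rewrite B0 setI0 leNgt (le_lt_trans (V0 n)).
Qed.

(** Otherwise [V n (A n `&` B `&` A m)] tends to [0] in [n] for all large [m],
    and along a sparse sequence [m], removing from [A (m j) `&` B] the sets
    [A (m i)], [i < j], costs less than half of the mass: the remainders are
    disjoint and keep masses at least [c / 2]. *)
Lemma frequentI B N : frequent B ->
  exists2 m, (N <= m)%N & frequent (B `&` A m).
Proof.
move=> [c c0 freq]; apply: contrapT => nfreq.
have small m d : (N <= m)%N -> 0 < d ->
    exists M, forall n, (M <= n)%N -> V n (A n `&` (B `&` A m)) < d.
  move=> Nm d0; apply: contrapT => /forallNP h; apply: nfreq; exists m => //.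
  exists d => // M; have /existsNP[n /not_implyP[Mn /negP]] := h M.
  by rewrite -leNgt; exists n.
have c2 : 0 < c / 2 by rewrite divr_gt0.
pose w i : R := 2^-1 ^+ i.
have w0 i : 0 < w i by rewrite exprn_gt0.
have /choice[T TP] (mi : nat * nat) : exists M, (N <= mi.1)%N ->
    forall n, (M <= n)%N -> V n (A n `&` (B `&` A mi.1)) < c / 2 * w mi.2.+1.
  have [Nm|Nm] := leqP N mi.1; last by exists 0%N.
  have [|M MP] := small mi.1 (c / 2 * w mi.2.+1) Nm; first exact: mulr_gt0.
  by exists M.
have /choice[pick pickP] (L : nat) : exists n, (L <= n)%N /\ c <= V n (A n `&` B).
  by have [n] := freq L; exists n.
(* [L i] exceeds all terms of the sequence [m] chosen before the [i]-th one and
   their thresholds [T] *)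
pose L := fix L i :=
  if i is i'.+1
  then maxn (L i') (maxn (pick (L i')).+1 (T (pick (L i'), i'))) else N.
pose m i := pick (L i).
have mL i : (L i <= m i)%N by case: (pickP (L i)).
have Lm i j : (i <= j)%N -> (L i <= L j)%N.
  move=> /subnKC <-; elim: (j - i)%N => [|d IH]; first by rewrite addn0.
  by rewrite addnS (leq_trans IH)//= leq_maxl.
have mS i : (m i < m i.+1)%N.
  by rewrite (leq_trans _ (mL _))//= !leq_max leqnn orbT.
have mT i j : (i < j)%N -> (T (m i, i) <= m j)%N.
  move=> ij; apply: leq_trans (mL j); apply: leq_trans (Lm _ _ ij).
  by rewrite /= !leq_max leqnn !orbT.
have Nm i : (N <= m i)%N by apply: leq_trans (mL i); exact: (Lm 0%N i).
pose rest j l := (A (m j) `&` B) `\` \bigcup_(i < l) A (m i).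
have restV j l : (l <= j)%N -> c <= V (m j) (rest j l) + c / 2 * (1 - w l).
  elim: l => [_|l IH lj].
    rewrite /rest bigcup_mkord big_ord0 setD0 /w expr0 subrr mulr0 addr0.
    by case: (pickP (L j)).
  have Vl : V (m j) (A (m j) `&` (B `&` A (m l))) < c / 2 * w l.+1.
    by apply: (TP (m l, l) (Nm l)); exact: mT.
  have := IH (ltnW lj).
  have : V (m j) (rest j l) <=
      V (m j) (rest j l.+1) + V (m j) (A (m j) `&` (B `&` A (m l))).
    apply: le_trans (VU _ _ _); apply: Vle => x [[Ax Bx] nx].
    have [Alx|nAlx] := pselect (A (m l) x); [by right|left; split=> //].
    move=> [i /= il Ai]; move: il; rewrite ltnS leq_eqVlt => /predU1P[il|il].
      by rewrite il in Ai.
    by apply: nx; exists i.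
  by move: Vl; rewrite /w exprS; lra.
have [|||j] := @Vdisjoint m (fun j => rest j j) (c / 2) _ _ _ => //.
  have disj i j : (i < j)%N -> rest i i `&` rest j j = set0.
    move=> ij; rewrite -subset0 => x [[[Ai _] _] [_ nA]].
    by apply: nA; exists i.
  by move=> i j /eqP; rewrite neq_ltn => /orP[/disj//|/disj]; rewrite setIC.
apply/negP; rewrite -leNgt; have := restV j j (leqnn _).
have := mulr_gt0 c2 (w0 j); rewrite mulrBr mulr1; lra.
Qed.

(** Intersecting repeatedly along [frequentI] never gives the empty set. *)
Lemma frequent_chain : frequent setT ->
  exists m j : nat -> nat, (forall i, (i <= m i)%N) /\
    forall i l, (i <= l)%N -> A (m i) (j l).
Proof.
move=> freqT.
have /choice[f fP] (Bn : set nat * nat) : exists m,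
    frequent Bn.1 -> (Bn.2 <= m)%N /\ frequent (Bn.1 `&` A m).
  have [fB|nfB] := pselect (frequent Bn.1); last by exists 0%N.
  by have [m] := frequentI Bn.2 fB; exists m.
pose B := fix B l := if l is l'.+1 then B l' `&` A (f (B l', l')) else setT.
have freqB l : frequent (B l).
  by elim: l => [//|l IH]; have [] := fP (B l, l) IH.
have /choice[j jP] l : exists j, B l.+1 j by exact: frequent_nonempty (freqB l.+1).
exists (fun l => f (B l, l)), j; split=> [i|i l il].
  by have [] := fP (B i, i) (freqB i).
suff : B l.+1 `<=` A (f (B i, i)) by apply; exact: jP.
rewrite -(subnKC il); elim: (l - i)%N => [|d IH]; first by rewrite addn0 => x [].
by rewrite addnS => x [/IH].
Qed.

End recurrence.

Section grothendieck_dunford_pettis.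
Context {R : realType} {k : scalar_kind}.
Local Notation K := (scalar_field R k).
Local Notation linfty := (linfty R k).

(** The Grothendieck and Dunford-Pettis properties of [linfty] in one statement.
    If [mu n (z n)] does not tend to [0], then the sets where [z n] exceeds a
    level [d] carry a fixed amount of the mass of [mu n] infinitely often.  By
    [frequent_chain] there are points [j l] lying in the first [l] of a
    subsequence of these sets, and the ultrafilter limit of evaluations at the
    [j l] is a functional bounded below by [d] along this subsequence of [z]. *)
Lemma linfty_limited_weakly_null (mu : nat -> linfty -> K) (z : nat -> linfty) :
  (forall n, linfty_functional (mu n)) -> pointwise_null mu ->
  linfty_weakly_null z -> null_scalars (fun n => mu n (z n)).
Proof.
move=> muP mu0 z0.
apply: contrapT => /existsNP[e /not_implyP[e0 /forallNP muz]].
have [C muC] := uniform_boundedness muP (fun f => null_scalars_bounded (mu0 f)).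
have [D zD] := linfty_weakly_null_bounded z0.
have C0 : 0 <= C by exact: le_trans (absmass_ge0 (muP 0%N) _) (muC 0%N).
have D0 : 0 <= D by exact: le_trans (sup_norm_ge0 _) (zD 0%N).
have C1 : 0 < C + 1 by rewrite ltr_wpDl.
have D1 : 0 < D + 1 by rewrite ltr_wpDl.
(* where [z n] is at most [d], it contributes at most [e / 2] *)
pose d := e / 2 / (C + 1); have d0 : 0 < d by rewrite !divr_gt0.
pose A n := [set j | d < modulus (z n j)].
have large n : e <= modulus (mu n (z n)) ->
    e / 2 / (D + 1) <= absmass (mu n) (A n `&` setT).
  move=> en; rewrite setIT ler_pdivrMr//.
  have [g gA g0] := restrict_ex (A n) (z n).
  have h1 : modulus (mu n g) <= absmass (mu n) (A n) * (D + 1).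
    apply: modulus_le_absmass_sup_norm => // j.
    have [/gA ->|/g0 ->] := pselect (A n j); last by rewrite modulus0 ltW.
    by rewrite (le_trans (modulus_le_sup_norm _ _))// (le_trans (zD n))// lerDl.
  have h2 : modulus (mu n (z n - g)) <= absmass (mu n) setT * d.
    apply: modulus_le_absmass_sup_norm => // [j|j /(_ I)//].
    rewrite linftyBE; have [/gA ->|] := pselect (A n j).
      by rewrite subrr modulus0 ltW.
    by move=> /[dup] /g0 -> /negP; rewrite -leNgt subr0.
  have h3 : absmass (mu n) setT * d <= e / 2.
    have : (C + 1) * d = e / 2 by rewrite /d mulrC divfK// gt_eqF.
    move=> <-; apply: ler_wpM2r; first exact: ltW.
    by rewrite (le_trans (muC n))// lerDl.
  have : modulus (mu n (z n)) <= modulus (mu n g) + modulus (mu n (z n - g)).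
    apply: le_trans (modulusD _ _).
    by rewrite -(functionalD (muP n)) [g + _]addrC subrK.
  move: en h1 h2 h3; set a := modulus _; set b := modulus _.
  by set c := modulus _; set p := _ * _; set q := _ * _; lra.
have [|||s B b sS Bdisj b0||m [j [mi Aj]]] :=
    @frequent_chain R (fun n => absmass (mu n)) A.
- by move=> n B B'; exact: le_absmass.
- by move=> n B B'; exact: absmassU_le.
- by move=> n; exact: absmass_set0.
- have sge i : (i <= s i)%N by elim: i => // i /leq_ltn_trans; apply.
  have [||i] := @phillips _ _ (mu \o s) B b _ _ Bdisj b0 => [i|f a a0|].
  + exact: muP.
  + have [N NP] := mu0 f a a0; exists N => n Nn; apply: NP.
    exact: leq_trans (sge n).
  + by exists i.
- exists (e / 2 / (D + 1)); first by rewrite !divr_gt0.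
  move=> N; have /existsNP[n /not_implyP[Nn /negP]] := muz N.
  by rewrite -leNgt => /large; exists n.
pose chi (f : linfty) : K := ulim (fun l => f (j l)).
have chib (f : linfty) : bounded_scalars (fun l => f (j l)).
  by exists (sup_norm f) => l; exact: modulus_le_sup_norm.
have chiP : linfty_functional chi.
  split=> [a f g|]; first exact: (ulim_linear a (chib f) (chib g)).
  exists 1 => f; rewrite mul1r -[chi f]subr0; apply: ulim_dist_le => //.
  by apply: filterS filterT => l _ /=; rewrite subr0 modulus_le_sup_norm.
have [N NP] := z0 chi chiP d d0.
have := NP (m N) (mi N); apply/negP; rewrite -leNgt; apply: ulim_ge => //.
apply: filterS (free_ultrafilter_ge N) => l /= Nl.
exact/ltW/Aj.
Qed.

End grothendieck_dunford_pettis.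

(** * The Hahn-Banach theorem over both scalar fields *)

Section hahn_banach.
Context {R : realType} {k : scalar_kind}.
Local Notation K := (scalar_field R k).
Variable E : lmodType K.
Implicit Types (x y : E) (r s t : R) (a : K) (p q : E -> R).

Local Notation "r *:: x" := (of_real R k r *: x) (at level 40).

Definition sublinear q := (forall x y, q (x + y) <= q x + q y) /\
  (forall r x, 0 <= r -> q (r *:: x) <= r * q x).

Section infimum.
Variables (I : Type) (i0 : I) (Q : I -> E -> R) (m : E -> R).
Hypothesis Qm : forall i x, m x <= Q i x.
Hypothesis QD : forall i j x y, exists l, Q l (x + y) <= Q i x + Q j y.
Hypothesis QZ : forall i r x, 0 <= r -> exists l, Q l (r *:: x) <= r * Q i x.

Let infQ x := inf (range (Q^~ x)).

Let has_infQ x : has_inf (range (Q^~ x)).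
Proof. by split; [exists (Q i0 x), i0|exists (m x) => _ [i _ <-]]. Qed.

(** Covers both uses of infima below: chains of sublinear functionals, where
    [l] is the smaller of [i] and [j], and the functionals of
    [sublinear_tilt]. *)
Lemma infimum_sublinear : exists q, [/\ sublinear q,
  (forall i x, q x <= Q i x) &
  (forall c x, (forall i, c <= Q i x) -> c <= q x)].
Proof.
have qle i x : infQ x <= Q i x by apply: ge_inf; [exact: (has_infQ x).2|exists i].
have leq c x : (forall i, c <= Q i x) -> c <= infQ x.
  by move=> h; apply: lb_le_inf; [exact: (has_infQ x).1|move=> _ [i _ <-]].
exists infQ; split=> //; split=> [x y|r x].
  rewrite -lerBlDr; apply: (leq _ x) => i; rewrite lerBlDr -lerBlDl.
  apply: (leq _ y) => j; rewrite lerBlDl; have [l] := QD i j x y.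
  exact: le_trans.
rewrite le_eqVlt => /predU1P[<-|r0].
  by have [l] := QZ i0 x (lexx 0); rewrite !mul0r; exact: le_trans (qle l _).
rewrite mulrC -ler_pdivrMr//; apply: (leq _ x) => i; rewrite ler_pdivrMr// mulrC.
by have [l] := QZ i x (ltW r0); exact: le_trans.
Qed.

End infimum.

Lemma sublinear0 q : sublinear q -> 0 <= q 0.
Proof. by move=> [qD _]; have := qD 0 0; rewrite addr0 -subr_ge0 addrK. Qed.

Lemma sublinearN q x : sublinear q -> - q (- x) <= q x.
Proof.
move=> qP; have := sublinear0 qP; have := qP.1 x (- x); rewrite subrr; lra.
Qed.

Lemma sublinearZ q r x : sublinear q -> 0 <= r -> r * q x <= q (r *:: x).
Proof.
move=> qP; rewrite le_eqVlt => /predU1P[<-|r0].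
  by rewrite mul0r of_real0 scale0r sublinear0.
rewrite mulrC -ler_pdivlMr// mulrC.
apply: le_trans (qP.2 _ (r *:: x) _); last by rewrite invr_ge0 ltW.
by rewrite scalerA -of_realM mulVf ?gt_eqF// of_real1 scale1r.
Qed.

(** The infimum of [q (x + t *:: y) - t * q y] over [t >= 0]; the two bounds are
    the cases [t = 0] and [t = 1].  It competes with [q] for minimality. *)
Lemma sublinear_tilt q y : sublinear q -> exists q', [/\ sublinear q',
  (forall x, q' x <= q x) & (forall x, q' x <= q (x + y) - q y)].
Proof.
move=> qP; have [qD qZ] := qP.
pose nneg := {t : R | 0 <= t}.
have tge0 (t : nneg) : 0 <= sval t by case: t.
pose Q (t : nneg) x := q (x + sval t *:: y) - sval t * q y.
have [|||q' [q'P q'le _]] := @infimum_sublinear nneg (exist _ 0 (lexx 0)) Q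
    (fun x => - q (- x)).
- move=> t x; have := qD (x + sval t *:: y) (- x); rewrite addrAC subrr add0r.
  by have := sublinearZ y qP (tge0 t); rewrite /Q; lra.
- move=> s t x x'; exists (exist _ (sval s + sval t) (addr_ge0 (tge0 s) (tge0 t))).
  rewrite /Q /= of_realD scalerDl addrACA.
  have := qD (x + sval s *:: y) (x' + sval t *:: y); lra.
- move=> t r x r0; exists (exist _ (r * sval t) (mulr_ge0 r0 (tge0 t))).
  rewrite /Q /= of_realM -scalerA -scalerDr.
  by have := qZ _ (x + sval t *:: y) r0; lra.
exists q'; split=> // x.
  have := q'le (exist _ 0 (lexx 0)) x.
  by rewrite /Q /= of_real0 scale0r addr0 mul0r subr0.
by have := q'le (exist _ 1 ler01) x; rewrite /Q /= of_real1 scale1r mul1r.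
Qed.

(** A minimal sublinear functional is additive, since tilting it in a direction
    [y] cannot lower it.  The minimal one is taken below the tilt of [p] along
    [x0], whose value at [- x0] is at most [- p x0]. *)
Lemma real_hahn_banach p x0 : sublinear p -> exists g : E -> R,
  [/\ (forall x, g x <= p x), p x0 <= g x0,
      (forall x y, g (x + y) = g x + g y) & (forall r x, g (r *:: x) = r * g x)].
Proof.
move=> pP; have [p1 [p1P p1p p1x0]] := sublinear_tilt x0 pP.
pose T := {q : E -> R | sublinear q /\ forall x, q x <= p1 x}.
pose below (q q' : T) := `[< forall x, sval q' x <= sval q x >].
have [||||[g [gP gp1]] gmin] := @Zorn T below.
- by move=> q; apply/asboolP.
- move=> q1 q2 q3 /asboolP q12 /asboolP q23; apply/asboolP => x.
  exact: le_trans (q12 x).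
- move=> [q qP] [q' q'P] /asboolP /= qq' /asboolP /= q'q; apply/eq_exist.
  by apply/funext => x; apply/le_anti; rewrite qq' q'q.
- move=> A Atot; have [[q0 Aq0]|A0] := pselect (A !=set0); last first.
    by exists (exist _ p1 (conj p1P (fun=> lexx _))) => q Aq; case: A0; exists q.
  pose I := {q : T | A q}.
  have [|||q [qP qle _]] := @infimum_sublinear I (exist _ q0 Aq0)
      (fun (i : I) x => sval (sval i) x) (fun x => - p1 (- x)).
  + move=> [[q [qP qp1]] /= _] x; apply: le_trans (sublinearN x qP).
    by rewrite lerN2.
  + move=> [q Aq] [q' Aq'] x y /=; have [qD _] := (svalP q).1.
    have [q'D _] := (svalP q').1.
    have [/asboolP le|/asboolP le] := Atot _ _ Aq Aq'.
      by exists (exist _ q' Aq') => /=; rewrite (le_trans (q'D x y))// lerD2r.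
    by exists (exist _ q Aq) => /=; rewrite (le_trans (qD x y))// lerD2l.
  + by move=> [q Aq] r x r0; exists (exist _ q Aq); exact: (svalP q).1.2.
  have qp1 x : q x <= p1 x.
    by apply: le_trans (qle (exist _ q0 Aq0) x) _; exact: (svalP q0).2.
  exists (exist _ q (conj qP qp1)) => q' Aq'; apply/asboolP => x /=.
  exact: (qle (exist _ q' Aq')).
have gD x y : g (x + y) = g x + g y.
  apply/le_anti; rewrite gP.1/=.
  have [g' [g'P g'g g'y]] := sublinear_tilt y gP.
  have g'p1 z : g' z <= p1 z by exact: le_trans (g'g z) (gp1 z).
  have := gmin (exist _ g' (conj g'P g'p1)).
  rewrite /below => /(_ (asboolT g'g)) /(congr1 sval) /= g'E.
  by have := g'y x; rewrite g'E; lra.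
have gN x : g (- x) = - g x.
  have g0 : g 0 = 0 by have := gD 0 0; rewrite addr0; lra.
  by have := gD x (- x); rewrite subrr g0; lra.
have gZ r x : 0 <= r -> g (r *:: x) = r * g x.
  by move=> r0; apply/le_anti; rewrite gP.2// sublinearZ.
exists g; split=> //.
- by move=> x; exact: le_trans (gp1 x) (p1p x).
- have := gp1 (- x0); have := p1x0 (- x0); rewrite addNr gN.
  have := pP.2 0 0 (lexx _); rewrite scaler0 mul0r; lra.
- move=> r x; have [r0|/ltW r0] := leP 0 r; first exact: gZ.
  rewrite -[r in LHS]opprK of_realN scaleNr gN gZ ?oppr_ge0//.
  by rewrite mulNr opprK.
Qed.

End hahn_banach.

(** In the complex case [f x] is [g x - 'i * g ('i *: x)], so that [g] is its
    real part; the last two clauses say what a real part satisfies for both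
    kinds of scalars. *)
Lemma complexify (R : realType) (k : scalar_kind)
    (E : lmodType (scalar_field R k)) (g : E -> R) :
  (forall x y, g (x + y) = g x + g y) ->
  (forall r x, g (of_real R k r *: x) = r * g x) ->
  exists f : E -> scalar_field R k,
    [/\ (forall a x y, f (a *: x + y) = a * f x + f y),
        (forall x, g x <= modulus (f x)) &
        (forall x r, f x = of_real R k r -> g x = r)].
Proof.
case: k E g => E g gD gZ.
  exists g; split=> [a x y|x|x r //]; first by rewrite gD gZ.
  exact: ler_norm.
pose f x : R[i]%C := (g x +i* - g ('i%C *: x))%C.
exists f; split=> [a x y|x|x r].
- have aE (z : E) : g (a *: z) = complex.Re a * g z + complex.Im a * g ('i%C *: z).
    rewrite -!gZ -gD; congr g; rewrite scalerA -scalerDl; congr (_ *: _).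
    by rewrite [LHS]complexE mulrC.
  have iE : g ('i%C *: ('i%C *: x)) = - g x.
    rewrite scalerA -expr2 sqr_i scaleN1r.
    have g0 : g 0 = 0 by have := gD 0 0; rewrite addr0; lra.
    by have := gD x (- x); rewrite subrr g0; lra.
  have comm : 'i%C *: (a *: x) = a *: ('i%C *: x) by rewrite !scalerA mulrC.
  rewrite /f gD scalerDr gD comm !aE iE.
  case: a {aE comm} => u v; apply/eqP; rewrite eq_complex/=.
  by apply/andP; split; apply/eqP; ring.
- have : complex.Re (f x) <= modulus (f x : scalar_field R ComplexScalars).
    rewrite /modulus normc_def /= (le_trans (ler_norm _))//.
    by rewrite -sqrtr_sqr ler_sqrt ?lerDl ?addr_ge0 ?sqr_ge0.
  by [].
- by case.
Qed.

(** The inequality in the second clause implies equality, because nonzero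
    scalars are invertible. *)
Definition seminorm (R : realType) (k : scalar_kind)
    (E : lmodType (scalar_field R k)) (p : E -> R) :=
  (forall x y, p (x + y) <= p x + p y) /\
  (forall a x, p (a *: x) <= modulus a * p x).

(** A functional whose real part is at most [p] has modulus at most [p], by
    rotating the argument so that the value is a nonnegative real. *)
Theorem hahn_banach (R : realType) (k : scalar_kind)
    (E : lmodType (scalar_field R k)) (p : E -> R) (x0 : E) : seminorm p ->
  exists f : E -> scalar_field R k,
    [/\ (forall a x y, f (a *: x + y) = a * f x + f y),
        (forall x, modulus (f x) <= p x) & p x0 <= modulus (f x0)].
Proof.
move=> [pD pZ]; have [|g [gp gx0 gD gZ]] := @real_hahn_banach R k E p x0.
  by split=> // r x r0; rewrite (le_trans (pZ _ _))// modulus_of_real ger0_norm.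
have [f [fL gf fg]] := complexify gD gZ.
exists f; split=> // [x|]; last exact: le_trans (gf x0).
have [c c1 cE] := phase_ex (f x).
have f0 : f 0 = 0.
  have := fL 1 0 0; rewrite scale1r mul1r addr0.
  by move=> /(congr1 (fun z => z - f 0)); rewrite subrr addrK.
have fcx : f (c *: x) = of_real R k (modulus (f x)).
  by rewrite -[c *: x]addr0 fL f0 addr0.
by rewrite -(fg _ _ fcx) (le_trans (gp _))// (le_trans (pZ _ _))// c1 mul1r.
Qed.

(** * Gauges of neighbourhoods *)

Section gauge.
Context {R : realType} {k : scalar_kind}.
Local Notation K := (scalar_field R k).
Variable E : tvsType K.
Implicit Types (V U : set E) (x y : E) (a : K) (r s : R).

Definition abs_convex U :=
  (forall a x, modulus a <= 1 -> U x -> U (a *: x)) /\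
  (forall r s x y, 0 <= r -> 0 <= s -> r + s = 1 -> U x -> U y ->
     U (of_real R k r *: x + of_real R k s *: y)).

Lemma convex_setE V r s x y : convex_set (V : set (convex_lmodType E)) ->
  0 <= r -> 0 <= s -> r + s = 1 -> V x -> V y ->
  V (of_real R k r *: x + of_real R k s *: y).
Proof.
move=> cV r0 s0 rs Vx Vy.
have r0' : 0 <= of_real R k r by rewrite -(@of_real0 R k) ler_of_real.
have r1' : of_real R k r <= 1 by rewrite -(@of_real1 R k) ler_of_real; lra.
have := cV x y (Itv01 r0' r1') (mem_set Vx) (mem_set Vy); rewrite inE.
suff -> : of_real R k s = 1 - of_real R k r by [].
by rewrite -(@of_real1 R k) -rs of_realD addrAC subrr add0r.
Qed.

(** The balanced core of a convex neighbourhood [b]; it is a neighbourhood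
    because scaling is continuous at [(0, 0)]. *)
Lemma abs_convex_nbhs V : nbhs 0 V ->
  exists U, [/\ nbhs 0 U, U `<=` V & abs_convex U].
Proof.
move=> V0; have [B Bconvex [Bopen Bbasis]] := @locally_convex K E.
have [b [Bb b0] bV] := Bbasis 0 V V0.
have cb := Bconvex b (mem_set Bb).
have nb : nbhs 0 b by apply: open_nbhs_nbhs; split => //; exact: Bopen.
exists [set x | forall a, modulus a <= 1 -> b (a *: x)]; split.
- have /= := @scale_continuous K E (0, 0) b; rewrite scaler0.
  move=> /(_ nb)[/= [B1 B2]] [/= B10 B20] B12.
  have [d /= d0 dB1] := (nbhs_ballP _ _).1 B10.
  have dp : 0 < d / 2 by rewrite divr_gt0.
  have d2 : d / 2 != 0 by rewrite gt_eqF.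
  apply: filterS (nbhs0Z d2 B20) => _ [x B2x <-] a a1.
  rewrite scalerA; apply: (B12 (a * (d / 2), x)); split=> //=; apply: dB1.
  rewrite -ball_normE /ball_/= sub0r normrN normrM (gtr0_norm dp).
  apply: (@le_lt_trans _ _ (d / 2)); last by rewrite gtr_pMr// invf_lt1// ltr1n.
  rewrite ger_pMl// -of_real_modulus -(@of_real1 R k) ler_of_real//.
- move=> x /(_ 1); rewrite modulus1 scale1r => /(_ (lexx 1)); exact: bV.
- split=> [a x a1 /= bx c c1|r s x y r0 s0 rs bx bY c c1] /=.
    rewrite scalerA; apply: bx; rewrite modulusM mulr_ile1 ?modulus_ge0//.
  rewrite scalerDr !scalerA ![c * _]mulrC -!scalerA.
  by apply: convex_setE => //; [exact: bx|exact: bY].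
Qed.

(** The Minkowski gauge of an absolutely convex neighbourhood. *)
Lemma seminorm_nbhs V : nbhs 0 V -> exists p : E -> R,
  [/\ seminorm p, nbhs 0 [set x | p x <= 1] & forall x, p x < 1 -> V x].
Proof.
move=> /abs_convex_nbhs[U [U0 UV [Ubal Uconv]]].
pose G x := [set r | 0 < r /\ U (of_real R k r^-1 *: x)].
pose p x := inf (G x).
have invZ r x : 0 < r -> of_real R k r *: (of_real R k r^-1 *: x) = x.
  by move=> r0; rewrite scalerA -of_realM divff ?gt_eqF// of_real1 scale1r.
have absorb x : exists r, G x r.
  have /= := @scale_continuous K E (0, x) U; rewrite scale0r.
  move=> /(_ U0)[/= [B1 B2]] [/= B10 B2x] B12.
  have [d /= d0 dB1] := (nbhs_ballP _ _).1 B10.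
  have e0 : 0 < modulus d / 2 by rewrite divr_gt0// modulus_gt0.
  exists (modulus d / 2)^-1; split; first by rewrite invr_gt0.
  rewrite invrK; apply: (B12 (of_real R k (modulus d / 2), x)); split=> /=.
    apply: dB1; rewrite -ball_normE /ball_/= sub0r normrN.
    rewrite -of_real_modulus modulus_of_real gtr0_norm//.
    rewrite [d in _ < d](of_real_modulus_gt0 d0) ltr_of_real.
    by rewrite gtr_pMr ?modulus_gt0// invf_lt1// ltr1n.
  exact: nbhs_singleton B2x.
have hasG x : has_inf (G x).
  by split; [exact: absorb|exists 0 => r [/ltW]].
have ple x r : G x r -> p x <= r.
  by move=> Gr; apply: ge_inf => //; exact: (hasG x).2.
have plt x r : p x < r -> exists2 s, s < r & G x s.
  by move=> /(inf_lt (hasG x).1)[s Gs sr]; exists s.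
exists p; split.
- split=> [x y|a x].
    apply/ler_addgt0Pl => e e0; have e2 : 0 < e / 2 by rewrite divr_gt0.
    have [|r re [r0 Ur]] := plt x (p x + e / 2); first by rewrite ltrDl.
    have [|s se [s0 Us]] := plt y (p y + e / 2); first by rewrite ltrDl.
    suff : p (x + y) <= r + s by lra.
    have rs0 : 0 < r + s by exact: addr_gt0.
    apply: ple; split=> //.
    have -> : of_real R k (r + s)^-1 *: (x + y) =
        of_real R k (r / (r + s)) *: (of_real R k r^-1 *: x) +
        of_real R k (s / (r + s)) *: (of_real R k s^-1 *: y).
      rewrite scalerDr !scalerA -!of_realM.
      by rewrite !(mulrAC _ (r + s)^-1) !divff ?gt_eqF// !mul1r.
    apply: Uconv => //; rewrite ?divr_ge0 ?ltW//.
    by rewrite -mulrDl divff// gt_eqF.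
  apply/ler_addgt0Pl => e e0.
  have a1 : 0 < modulus a + 1 by rewrite ltr_wpDl ?modulus_ge0.
  have d0 : 0 < e / (modulus a + 1) by rewrite divr_gt0.
  have [|r re [r0 Ur]] := plt x (p x + e / (modulus a + 1)).
    by rewrite ltrDl.
  have dE : e / (modulus a + 1) * (modulus a + 1) = e by rewrite divfK// gt_eqF.
  have h : modulus a * r <=
      modulus a * p x + modulus a * (e / (modulus a + 1)).
    by rewrite -mulrDr ler_wpM2l ?modulus_ge0// ltW.
  have [a0|a0] := eqVneq a 0.
    rewrite a0 scale0r modulus0 mul0r addr0; apply: ple; split=> //.
    by rewrite scaler0; exact: nbhs_singleton.
  have ma : 0 < modulus a.
    rewrite lt_neqAle modulus_ge0 andbT eq_sym; apply/eqP => /modulus_eq0 /eqP.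
    exact/negP.
  apply: (@le_trans _ _ (modulus a * r)).
    apply: ple; split; first exact: mulr_gt0.
    have -> : of_real R k (modulus a * r)^-1 *: (a *: x) =
        (of_real R k (modulus a)^-1 * a) *: (of_real R k r^-1 *: x).
      rewrite !scalerA invfM of_realM; congr (_ *: _).
      by rewrite -!mulrA; congr (_ * _); rewrite mulrC.
    apply: Ubal => //.
    by rewrite modulusM modulus_of_real gtr0_norm ?invr_gt0// mulVf ?gt_eqF.
  by move: h; rewrite mulrDr mulr1 in dE; lra.
- apply: filterS U0 => x Ux; apply: ple; split=> //.
  by rewrite invr1 of_real1 scale1r.
- move=> x /plt[r r1 [r0 Ur]]; apply: UV; rewrite -(invZ r x r0); apply: Ubal => //.
  by rewrite modulus_of_real gtr0_norm// ltW.
Qed.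

End gauge.

(** * Continuity of functionals and operators *)

Section continuity.
Context {R : realType} {k : scalar_kind}.
Local Notation K := (scalar_field R k).
Local Notation linfty := (linfty R k).

Lemma null_scalarsP (u : nat -> K^o) : u @ \oo --> (0 : K^o) <-> null_scalars u.
Proof.
split=> [/cvg0_modulusP u0 e /u0[N _ h]|u0]; first by exists N.
by apply/cvg0_modulusP => e /u0[N h]; exists N.
Qed.

Lemma ell_c0_null (p : \bar R) (u : nat -> K) : (1%:E <= p)%E ->
  ell_c0 p (fun n => modulus (u n)) -> null_scalars u.
Proof.
case: p => [r| |]//= r1 pu e e0.
  have r0 : 0 < r by rewrite lee_fin in r1; apply: lt_le_trans r1.
  have /cvgr0Pnorm_lt /(_ _ (powR_gt0 r e0))[N _ h] := cvg_series_cvg_0 pu.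
  exists N => n /h /=; rewrite ger0_norm ?powR_ge0// ger0_norm ?modulus_ge0//.
  apply: contraTT; rewrite -!leNgt => h'.
  apply: ge0_ler_powR => //; rewrite ?nnegrE ?modulus_ge0//; exact: ltW.
have /cvgr0Pnorm_lt /(_ _ e0)[N _ h] := pu.
by exists N => n /h /=; rewrite ger0_norm ?modulus_ge0.
Qed.

Lemma seminorm_continuous (E : tvsType K) (F : normedModType K) (p : E -> R)
    (T : E -> F) : seminorm p -> nbhs 0 [set x | p x <= 1] ->
  (forall a x y, T (a *: x + y) = a *: T x + T y) ->
  (forall x, `|T x| <= of_real R k (p x)) -> continuous T.
Proof.
move=> [pD pZ] p1 TL Tp x; apply/cvgrPdist_lt => e e0.
have me := modulus_gt0 e0.
have e2 : of_real R k (modulus e / 2) != 0.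
  by rewrite -(@of_real0 R k) (inj_eq (@of_real_inj R k)) gt_eqF// divr_gt0.
apply: filterS (nbhsT x (nbhs0Z e2 p1)) => _ [_ [y /= py <-] <-].
have -> : T x - T (x + of_real R k (modulus e / 2) *: y) =
    - (of_real R k (modulus e / 2) *: T y).
  by rewrite [x + _]addrC TL opprD addrCA subrr addr0.
rewrite normrN normrZ [e in _ < e](of_real_modulus_gt0 e0).
apply: (@le_lt_trans _ _ (of_real R k (modulus e / 2) * 1)).
  rewrite -of_real_modulus modulus_of_real gtr0_norm ?divr_gt0//.
  apply: ler_wpM2l; first by rewrite ltW// of_real_gt0 divr_gt0.
  by rewrite (le_trans (Tp y))// -(@of_real1 R k) ler_of_real.
by rewrite mulr1 ltr_of_real gtr_pMr// invf_lt1// ltr1n.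
Qed.

Lemma linfty_normE (f : linfty) : `|f| = of_real R k (sup_norm f).
Proof. by []. Qed.

Lemma topdual_linear (E : preTopologicalLmodType K) (eta : topdual E) a x y :
  eta (a *: x + y) = a * eta x + eta y.
Proof. by have /asboolP[+ _] := topdualP eta; apply. Qed.

Lemma topdual_continuous (E : preTopologicalLmodType K) (eta : topdual E) :
  continuous eta.
Proof. by have /asboolP[] := topdualP eta. Qed.

Lemma topdual_build (E : preTopologicalLmodType K) (f : E -> K^o) :
  (forall a x y, f (a *: x + y) = a * f x + f y) -> continuous f ->
  exists eta : topdual E, forall x, eta x = f x.
Proof.
move=> fl fc; have fP : f \in @continuous_functional K E by apply/asboolP.
by exists (Topdual fP).
Qed.

Lemma continuous_linfty_functional (mu : linfty -> K^o) :
  (forall a f g, mu (a *: f + g) = a * mu f + mu g) -> continuous mu ->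
  linfty_functional mu.
Proof.
move=> muL muc; split=> //.
pose h : {linear linfty -> K^o} :=
  HB.pack mu (GRing.isLinear.Build _ _ _ _ _ muL).
have /linear_boundedP/filter_ex[r hr] :=
  continuous_linear_bounded 0 (muc 0 : {for 0, continuous h}).
(* [r] is only known as a scalar; [r * `|f|] is nonnegative, hence equal to its
   norm *)
exists (modulus r) => f; have rf := hr f.
have rfE : r * `|f| = of_real R k (modulus r * sup_norm f).
  rewrite -[LHS](ger0_norm (le_trans (normr_ge0 _) rf)) normrM normr_id.
  by rewrite of_realM of_real_modulus.
by rewrite -(@ler_of_real R k) -rfE of_real_modulus.
Qed.

Lemma linfty_functional_continuous (mu : linfty -> K^o) :
  linfty_functional mu -> continuous mu.
Proof.
move=> [muL [C muC]].
pose h : {linear linfty -> K^o} :=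
  HB.pack mu (GRing.isLinear.Build _ _ _ _ _ muL).
apply: (@bounded_linear_continuous _ _ _ h); apply/linear_boundedP.
have Cr : of_real R k C \is Num.real.
  by case: (lerP 0 C) => [C0|/ltW C0]; [apply: ger0_real|apply: ler0_real];
    rewrite -(@of_real0 R k) ler_of_real.
near=> r => f; apply: (@le_trans _ _ (of_real R k C * `|f|)).
  by rewrite -of_real_modulus linfty_normE -of_realM ler_of_real.
by apply: ler_wpM2r => //; near: r; exact: nbhs_pinfty_ge.
Unshelve. all: by end_near. Qed.

End continuity.

(** * The equivalence *)

Section operators.
Context {R : realType} {k : scalar_kind}.
Local Notation K := (scalar_field R k).

(** Singletons are bounded, so the strong topology refines pointwise
    convergence. *)
Lemma strong_dual_eval_continuous (L : tvsType K) (x : L) :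
  continuous ((fun eta : strong_dual L => eta x) : strong_dual L -> K^o).
Proof.
move=> eta; have bx : @vn_bounded K L [set x].
  move=> U U0.
  have /= := @scale_continuous K L (0, x) U; rewrite scale0r.
  move=> /(_ U0)[/= [B1 B2]] [/= B10 B2x] B12.
  have [d /= d0 dB1] := (nbhs_ballP _ _).1 B10.
  have d2 : 0 < d / 2 by rewrite divr_gt0.
  exists (d / 2)^-1; first by rewrite invr_gt0.
  move=> t td _ ->; have t0 : 0 < `|t| by apply: lt_le_trans td; rewrite invr_gt0.
  exists (t^-1 *: x); last by rewrite scalerA divff ?scale1r// -normr_gt0.
  apply: (B12 (t^-1, x)); split=> /=; last exact: nbhs_singleton B2x.
  apply: dB1; rewrite -ball_normE /ball_/= sub0r normrN normfV.
  apply: (@le_lt_trans _ _ (d / 2)); last by rewrite gtr_pMr// invf_lt1// ltr1n.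
  by rewrite -[leRHS]invrK lef_pV2 ?posrE ?invr_gt0.
have FF : Filter (@to_family K L @ nbhs (eta : strong_dual L)).
  exact: fmap_filter.
have eta_cvg := @initial_continuous _ _ (@to_family K L) eta.
have := (fam_cvgP _ _ FF).1 eta_cvg _ bx.
by rewrite (uniform_set1 _ _ FF).
Qed.

Lemma weakly_null_weakstar_null (L : tvsType K) (eta : nat -> topdual L) :
  weakly_null (eta : nat -> strong_dual L) -> weakstar_null eta.
Proof.
move=> eta0 x.
have [|ev evE] := @topdual_build R k (strong_dual L) (fun eta => eta x) _
  (@strong_dual_eval_continuous L x); first by [].
by have := eta0 ev; under eq_fun do rewrite evE.
Qed.

Lemma weakstar_p_convergent_weakly (p : \bar R) (E L : tvsType K)
    (T : {linear E -> L}) :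
  weakstar_p_convergent p T -> weakly_p_convergent p T.
Proof. by move=> Tp eta x /weakly_null_weakstar_null eta0; exact: Tp. Qed.

(** The operator [T] maps weakly [p]-summable sequences to weakly null ones, and
    [J] pulls weak* null sequences back to weak* null ones, so that
    [linfty_limited_weakly_null] applies. *)
Lemma factor_weakstar_p_convergent (p : \bar R) (E L : tvsType K)
    (T : {linear E -> linfty R k}) (J : {linear linfty R k -> L}) :
  (1%:E <= p)%E -> continuous T -> continuous J ->
  weakstar_p_convergent p (J \o T : {linear E -> L}).
Proof.
move=> p1 Tc Jc eta y eta0 yp; apply/null_scalarsP.
apply: (@linfty_limited_weakly_null R k (fun n f => eta n (J f)) (fun n => T (y n))).
- move=> n; apply: continuous_linfty_functional.
    by move=> a f g; rewrite linearP topdual_linear.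
  by move=> f; apply: continuous_comp; [exact: Jc|exact: topdual_continuous].
- by move=> f; apply/null_scalarsP; exact: eta0.
- move=> chi chiP.
  have [|f|chiT chiTE] := @topdual_build R k E (fun x => chi (T x)).
  + by move=> a x z; rewrite linearP chiP.1.
  + apply: continuous_comp; first exact: Tc.
    exact: (linfty_functional_continuous chiP).
  + have := ell_c0_null p1 (yp chiT).
    by under eq_fun do rewrite chiTE.
Qed.

(** A continuous seminorm stays at least [1] along infinitely many terms; the
    coordinates of the operator are functionals norming these terms. *)
Lemma norming_operator (E : tvsType K) (x : nat -> E) :
  ~ x @ \oo --> (0 : E) ->
  exists T : {linear E -> linfty R k},
    continuous T /\ ~ T \o x @ \oo --> (0 : linfty R k).
Proof.
move=> /existsNP[V /not_implyP[V0 xV]].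
have [p [pP p1 pV]] := seminorm_nbhs V0.
have /choice[chi chiP] n := hahn_banach (x n) pP.
have /choice[T TP] y : exists f : linfty R k,
    (forall n, f n = chi n y) /\ sup_norm f <= p y.
  have [|f fE fp] := @linfty_build R k (chi^~ y) (p y).
    by move=> n; case: (chiP n).
  by exists f.
have TL a y z : T (a *: y + z) = a *: T y + T z.
  apply: linfty_eq => n; rewrite linftyDE linftyZE !(TP _).1.
  by case: (chiP n).
pose T' : {linear E -> linfty R k} :=
  HB.pack T (GRing.isLinear.Build _ _ _ _ _ TL).
exists T'; split.
  apply: (seminorm_continuous pP p1 TL) => y.
  by rewrite linfty_normE ler_of_real; case: (TP y).
move=> /cvgr0Pnorm_lt /(_ 1 ltr01)[N _ hN]; apply: xV; exists N => // n /hN /=.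
rewrite linfty_normE -(@of_real1 R k) ltr_of_real => xn; apply: pV.
apply: le_lt_trans xn; have [_ _ /le_trans] := chiP n; apply.
by rewrite -(TP (x n)).1 modulus_le_sup_norm.
Qed.

Lemma linfty_embedding_cvg0 (L : tvsType K) (J : {linear linfty R k -> L})
    (J' : L -> linfty R k) (u : nat -> linfty R k) :
  cancel J J' -> {within range J, continuous J'} ->
  J \o u @ \oo --> (0 : L) -> u @ \oo --> (0 : linfty R k).
Proof.
move=> JK /subspace_continuousP/(_ 0) J'c Ju.
have J0 : J 0 = 0 by rewrite linear0.
have J'0 : J' 0 = 0 by rewrite -J0 JK.
have -> : u = J' \o (J \o u) by apply/funext => n /=; rewrite JK.
rewrite -[X in _ --> X]J'0.
apply: (@cvg_comp _ _ _ (J \o u) J' \oo (within (range J) (nbhs 0))).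
  move=> A /Ju [N _ AN]; exists N => // n Nn /=.
  by apply: AN => //; exists (u n).
by apply: J'c; exists 0.
Qed.

End operators.

Theorem theorem3p8 (R : realType) (k : scalar_kind) (p q q' : \bar R)
    (E L : tvsType (scalar_field R k))
    (hp : (1%:E <= p)%E) (hq : (1%:E <= q)%E) (hq' : (1%:E <= q')%E)
    (hq'q : (q' <= q)%E)
    (hE : hausdorff_space E) (hL : hausdorff_space L)
    (hlinfty : contains_linfty L) :
  let assertion_i := forall T : {linear E -> L}, continuous T ->
    weakly_p_convergent p T -> limited_p_convergent q' q p T in
  let assertion_ii := forall T : {linear E -> L}, continuous T ->
    weakstar_p_convergent p T -> limited_p_convergent q' q p T in
  let assertion_iii := limited_p_convergent q' q p (idfun : {linear E -> E}) in
  (assertion_i <-> assertion_ii) /\ (assertion_ii <-> assertion_iii).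
Proof.
move=> i ii iii.
have i_ii : i -> ii by move=> Hi T Tc /weakstar_p_convergent_weakly; exact: Hi.
have ii_iii : ii -> iii.
  move=> Hii x xp xlim; apply: contrapT => x0.
  have [J [J' [Jc JK J'c]]] := hlinfty.
  have [T [Tc Tx]] := norming_operator x0; apply: Tx.
  apply: (linfty_embedding_cvg0 JK J'c).
  apply: (Hii (J \o T : {linear E -> L})) => //.
    by move=> y; apply: continuous_comp; [exact: Tc|exact: Jc].
  exact: factor_weakstar_p_convergent.
have iii_i : iii -> i.
  move=> Hiii T Tc _ x xp xlim.
  have T0 : T 0 = 0 by rewrite linear0.
  rewrite -[X in _ --> X]T0.
  by apply: (@cvg_comp _ _ _ x T); [exact: Hiii|exact: Tc].
by split; split=> // h; [exact/iii_i/ii_iii|exact/i_ii/iii_i].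
Qed.
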